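(* Let $0<q<1$, and let $a,b$ be real numbers with $0<a<q^{-1}$ and $b<q^{-1}$. Put $\mu(m)=q^{-m}+ab\,q^{m+1}$ for $m=0,1,2,\dots$, and let $d_n(\mu(m))\equiv d_n(\mu(m);a,b|q)$, $n=0,1,2,\dots$, be the dual little $q$-Jacobi polynomials. Then for all nonnegative integers $n,n'$ $$\sum_{m=0}^\infty \frac{(1-abq^{2m+1})(abq,bq;q)_m}{(1-abq)(aq,q;q)_m}\,a^m q^{m^2}\,d_n(\mu(m))\,d_{n'}(\mu(m))=\frac{(abq^2;q)_\infty}{(aq;q)_\infty}\,\frac{(q;q)_n(aq)^{-n}}{(bq;q)_n}\,\delta_{nn'} .$$ Moreover, the point measure in this relation is extremal for the polynomials $d_n$: the polynomials $d_n$, $n=0,1,2,\dots$, form an orthogonal basis of the Hilbert space $\mathfrak{l}^2$ of functions on $\{0,1,2,\dots\}$ with scalar product $$\langle f_1,f_2\rangle=\sum_{m=0}^\infty\frac{(1-abq^{2m+1})(abq,bq;q)_m}{(1-abq)(aq,q;q)_m}\,a^m q^{m^2}f_1(m)\overline{f_2(m)}.$$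
   Context: Notation: $(x;q)_k=\prod_{j=0}^{k-1}(1-xq^j)$, $(x;q)_\infty=\prod_{j\ge0}(1-xq^j)$, $(x_1,\dots,x_r;q)_k=\prod_i(x_i;q)_k$. Basic hypergeometric series: ${}_r\phi_s(\alpha_1,\dots,\alpha_r;\beta_1,\dots,\beta_s;q,z)=\sum_{k\ge0}\frac{(\alpha_1,\dots,\alpha_r;q)_k}{(\beta_1,\dots,\beta_s,q;q)_k}\big[(-1)^kq^{k(k-1)/2}\big]^{1+s-r}z^k$. Dual little $q$-Jacobi polynomials: $d_n(\mu(m);a,b|q)={}_3\phi_1(q^{-m},abq^{m+1},q^{-n};\,bq;\,q,q^n/a)$, a polynomial of degree $n$ in $\mu(m)=q^{-m}+abq^{m+1}$, since $(q^{-m},abq^{m+1};q)_k=\prod_{j=0}^{k-1}(1+abq^{2j+1}-q^j\mu(m))$. The quotient $(1-abq^{2m+1})(abq;q)_m/(1-abq)$ is understood with the common factor $1-abq$ cancelled (it equals $1$ for $m=0$ and $(1-abq^{2m+1})(abq^2;q)_{m-1}$ for $m\ge1$). A measure $\mu$ with respect to which a family of polynomials is orthogonal is called extremal if the family is complete in $L^2(\mu)$. *)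

(* Defs.v *)
From HB Require Import structures.
From mathcomp Require Import all_boot all_order all_algebra.
From mathcomp Require Import all_classical all_reals all_analysis.
From mathcomp Require Import complex.

Set Implicit Arguments.
Unset Strict Implicit.
Unset Printing Implicit Defensive.

Import Order.TTheory GRing.Theory Num.Theory.
Import numFieldNormedType.Exports.

Local Open Scope classical_set_scope.
Local Open Scope ring_scope.
Local Open Scope complex_scope.

Section QSeries.
Variable R : realType.
Implicit Types (x q z : R) (k : nat).

Definition qpoch x q k : R := \prod_(j < k) (1 - x * q ^+ j).

Definition qpoch_inf x q : R := limn (qpoch x q : R^nat).

Definition qpochs (xs : seq R) q k : R := \prod_(x <- xs) qpoch x q k.

(* The exponent [1 + s - r] is an integer, possibly negative, whence [^]. *)
Definition rphis (alphas betas : seq R) q z : R :=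
  limn (series (fun k =>
    qpochs alphas q k / qpochs (rcons betas q) q k
    * ((-1) ^+ k * q ^+ 'C(k, 2)) ^
        (1 + (size betas)%:Z - (size alphas)%:Z)
    * z ^+ k) : R^nat).

End QSeries.

Section DualLittleQJacobi.
Variables (R : realType) (q a b : R).
Implicit Types n m : nat.

Definition dual_node m : R := q ^- m + a * b * q ^+ m.+1.

(* [dual_qJacobi n m] is the value $d_n(\mu(m); a, b | q)$. *)
Definition dual_qJacobi n m : R :=
  rphis [:: q ^- m; a * b * q ^+ m.+1; q ^- n] [:: b * q] q (q ^+ n / a).

(* $(1-abq^{2m+1})(abq;q)_m/(1-abq)$ with the factor $1-abq$ cancelled, so that
   it keeps its meaning when $abq = 1$. *)
Definition dual_quot m : R :=
  if m is m'.+1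
  then (1 - a * b * q ^+ (2 * m).+1) * qpoch (a * b * q ^+ 2) q m'
  else 1.

Definition dual_weight m : R :=
  dual_quot m * qpoch (b * q) q m / (qpoch (a * q) q m * qpoch q q m)
  * a ^+ m * q ^+ (m ^ 2).

End DualLittleQJacobi.

Section WeightedL2.
Variables (R : realType) (w : nat -> R).
Implicit Types (f g : nat -> R[i]) (e : nat -> nat -> R[i]).

Definition l2 f : Prop :=
  cvgn (series (fun m => w m * Normc.normc (f m) ^+ 2) : R^nat).

Definition l2_dot f g : R[i] :=
  limn (series (fun m => (w m)%:C * f m * Num.conj (g m)) : nat -> R[i]^o).

Definition l2_norm f : R := Num.sqrt (complex.Re (l2_dot f f)).

Definition l2_complete e : Prop :=
  forall f, l2 f -> forall eps : R, 0 < eps ->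
    exists (N : nat) (c : nat -> R[i]),
      l2_norm (fun m => f m - \sum_(n < N) c n * e n m) < eps.

Definition l2_orthogonal_basis e : Prop :=
  [/\ forall n, l2 (e n),
      forall n, l2_dot (e n) (e n) != 0,
      forall n n', n != n' -> l2_dot (e n) (e n') = 0
    & l2_complete e].

End WeightedL2.

Section Extremal.
Variable R : realType.
Implicit Types (nu : {measure set (measurableTypeR R) -> \bar R})
  (p : nat -> {poly R}).

(* [nu] is the measure $\sum_m w_m \delta_{x_m}$ on the Borel sets of the
   line. *)
Definition is_point_measure nu (w x : nat -> R) : Prop :=
  forall A : set (measurableTypeR R), measurable A ->
    nu A = (\sum_(0 <= m <oo) (w m)%:E * \d_(x m) A)%E.

Definition sqnorm_int nu (f : R -> R[i]) : \bar R :=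
  (\int[nu]_x (Normc.normc (f x) ^+ 2)%R%:E)%E.

Definition measurable_cfun (f : R -> R[i]) : Prop :=
  measurable_fun setT ((fun x => complex.Re (f x)) : measurableTypeR R -> R) /\
  measurable_fun setT ((fun x => complex.Im (f x)) : measurableTypeR R -> R).

(* Complex square-integrable functions; as usual, representatives rather than
   classes modulo $\nu$-null functions. *)
Definition L2 nu (f : R -> R[i]) : Prop :=
  measurable_cfun f /\ (sqnorm_int nu f < +oo)%E.

Definition orthogonal_polys nu p : Prop :=
  [/\ forall n, L2 nu (fun x => (p n).[x]%:C),
      forall n, (\int[nu]_x ((p n).[x] ^+ 2)%R%:E)%E != 0%E
    & forall n n', n != n' -> (\int[nu]_x ((p n).[x] * (p n').[x])%R%:E)%E = 0%E].

Definition L2_complete nu p : Prop :=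
  forall f, L2 nu f -> forall eps : R, 0 < eps ->
    exists (N : nat) (c : nat -> R[i]),
      (sqnorm_int nu (fun x => f x - \sum_(n < N) c n * (p n).[x]%:C)%R
         < (eps ^+ 2)%:E)%E.

Definition extremal nu p : Prop := orthogonal_polys nu p /\ L2_complete nu p.

End Extremal.

(* Main.v *)
Require Import Defs.
From mathcomp Require Import all_boot all_order all_algebra.
From mathcomp Require Import all_classical all_reals all_analysis.
From mathcomp Require Import measurable_realfun complex.
From mathcomp Require Import ring lra.

Set Implicit Arguments.
Unset Strict Implicit.
Unset Printing Implicit Defensive.

Import Order.TTheory GRing.Theory Num.Theory.
Import numFieldNormedType.Exports.

Local Open Scope classical_set_scope.
Local Open Scope ring_scope.
Local Open Scope complex_scope.

(** The dual little q-Jacobi polynomials are the little q-Jacobi polynomials with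
    degree and variable exchanged. In the terminating 3phi1 series, the factors
    that depend on n combine to (1 - x)(1 - x/q)...(1 - x/q^(k-1)) at x = q^n, so
    that d_n(mu(m)) = D_m(q^n), where D_m is a polynomial of degree m, the little
    q-Jacobi polynomial normalised by D_m(1) = 1 ([little_jacobi],
    [dual_qJacobi_dvec]).

    The D_m are orthogonal on the points q^n with the weights
    W_n = (bq; q)_n (aq)^n / (q; q)_n. Indeed the moment of D_m against x^l is
    computed by the q-binomial theorem ([q_binomial]) followed by a
    q-Chu-Vandermonde sum ([q_chu_vandermonde]); it vanishes for l < m, and for
    l = m it yields the squared norm kappa / w_m, where w_m is the dual weight and
    kappa = (abq^2; q)_oo / (aq; q)_oo ([jacobi_orth]). As the points q^n accumulate
    only at 0, suitable polynomials in x converge in l2(W) to each unit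
    sequence ([expands_delta_jvec]), so that the D_m are complete in l2(W).

    Hence the matrix with entries (W_n w_m / kappa)^(1/2) D_m(q^n) has orthonormal
    rows, by the orthogonality of the D_m, and orthonormal columns, by the
    Parseval identity for pairs of unit sequences. The latter is the asserted
    orthogonality relation of the d_n ([dual_orth]); read in l2(w), the former is
    the Parseval identity for the unit sequences, whence the d_n are complete in
    l2(w) ([dual_complete]). Complex sequences are treated through their
    real and imaginary parts ([l2_basis]), and square-integrable functions on the
    line through their values at the nodes ([extremal_point_measure]). *)

(** * Convergent real series *)

Lemma cvg_seq_ext (T : topologicalType) (u v : nat -> T) (l : T) :
  (forall n, u n = v n) -> u @ \oo --> l -> v @ \oo --> l.
Proof. by move=> /funext ->. Qed.

Lemma series_cvg_ext (R : realType) (u v : nat -> R) (l : R) :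
  (forall n, u n = v n) -> series u @ \oo --> l -> series v @ \oo --> l.
Proof. by move=> /funext ->. Qed.

Lemma series_cvgD (R : realType) (u v : nat -> R) (l l' : R) :
  series u @ \oo --> l -> series v @ \oo --> l' ->
  series (fun n => u n + v n) @ \oo --> l + l'.
Proof.
move=> ul vl; rewrite (_ : series _ = series u + series v); first exact: cvgD.
exact: (seriesD u v).
Qed.

Lemma series_cvgZ (R : realType) (k : R) (u : nat -> R) (l : R) :
  series u @ \oo --> l -> series (fun n => k * u n) @ \oo --> k * l.
Proof.
move=> ul; rewrite (_ : series _ = fun n => k * series u n); first exact: cvgMr.
by apply/funext => n; rewrite /series/= mulr_sumr.
Qed.

Arguments series_cvgZ {R} k {u l}.

Lemma series_cvgB (R : realType) (u v : nat -> R) (l l' : R) :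
  series u @ \oo --> l -> series v @ \oo --> l' ->
  series (fun n => u n - v n) @ \oo --> l - l'.
Proof.
move=> ul /(series_cvgZ (-1)) vl; rewrite -[- l']mulN1r.
by apply: series_cvg_ext (series_cvgD ul vl) => n; rewrite mulN1r.
Qed.

(** * Weighted real l2 spaces *)

Section WeightedRealL2.
Variables (R : realType) (w : nat -> R).
Hypothesis w_ge0 : forall m, 0 <= w m.
Implicit Types u v e : nat -> R.

(** The real sequence [u] lies in the weighted space l2(w). *)
Definition sq_summable u : Prop :=
  cvgn (series (fun m => w m * u m ^+ 2) : R^nat).

(** Scalar product of l2(w), real case. As a limit, it is meaningful when both
    arguments are square-summable; [wdot u u] is the squared norm of [u]. *)
Definition wdot u v : R := limn (series (fun m => w m * u m * v m) : R^nat).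

Lemma cvg_wdot u v : sq_summable u -> sq_summable v ->
  series (fun m => w m * u m * v m) @ \oo --> wdot u v.
Proof.
move=> su sv; apply: normed_cvg.
apply: (@series_le_cvg _ _ ((fun m => w m * u m ^+ 2) + (fun m => w m * v m ^+ 2))).
- by move=> n; apply: normr_ge0.
- by move=> n; apply: addr_ge0; rewrite mulr_ge0 ?sqr_ge0.
- move=> n; change (`|w n * u n * v n| <= w n * u n ^+ 2 + w n * v n ^+ 2).
  rewrite -mulrDr -mulrA normrM (ger0_norm (w_ge0 n)) ler_wpM2l//.
  by rewrite ler_norml; apply/andP; split; nra.
- by apply: is_cvg_seriesD.
Qed.

Lemma wdotC u v : wdot u v = wdot v u.
Proof.
rewrite /wdot; congr (limn (series _)).
by apply/funext => m; ring.
Qed.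

Lemma cvg_sqnorm u : sq_summable u ->
  series (fun m => w m * u m ^+ 2) @ \oo --> wdot u u.
Proof.
move=> su; have := cvg_wdot su su; by apply: series_cvg_ext => m; ring.
Qed.

Lemma wdot_ge0 u : sq_summable u -> 0 <= wdot u u.
Proof.
move=> su; apply: limr_ge; first exact: cvg_wdot.
by apply: nearW => n; apply: sumr_ge0 => i _; rewrite -mulrA mulr_ge0// -expr2 sqr_ge0.
Qed.

Lemma wdotP u v s : series (fun m => w m * u m * v m) @ \oo --> s -> wdot u v = s.
Proof. by move=> /(cvg_lim (@Rhausdorff R)). Qed.

Lemma sq_summableD u v : sq_summable u -> sq_summable v ->
  sq_summable (fun m => u m + v m).
Proof.
move=> su sv; rewrite /sq_summable.
rewrite (_ : (fun m => _) = (fun m => w m * u m ^+ 2) +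
   ((fun m => w m * v m ^+ 2) + 2 *: (fun m => w m * u m * v m))).
  apply: is_cvg_seriesD => //; apply: is_cvg_seriesD => //.
  by apply: is_cvg_seriesZ; exact: cvgP (cvg_wdot su sv).
apply/funext => m.
change (w m * (u m + v m) ^+ 2 =
  w m * u m ^+ 2 + (w m * v m ^+ 2 + 2 * (w m * u m * v m))).
by ring.
Qed.

Lemma sq_summableZ k u : sq_summable u -> sq_summable (fun m => k * u m).
Proof.
move=> su; rewrite /sq_summable.
rewrite (_ : (fun m => _) = k ^+ 2 *: (fun m => w m * u m ^+ 2)).
  exact: is_cvg_seriesZ.
apply/funext => m; change (w m * (k * u m) ^+ 2 = k ^+ 2 * (w m * u m ^+ 2)).
by ring.
Qed.

Lemma sq_summable0 : sq_summable (fun=> 0).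
Proof.
rewrite /sq_summable (_ : series _ = (fun=> 0)); first exact: is_cvg_cst.
by apply/funext => n; rewrite /series/= big1// => i _; rewrite expr2 !mulr0.
Qed.

Lemma wdotDl u u' v : sq_summable u -> sq_summable u' -> sq_summable v ->
  wdot (fun m => u m + u' m) v = wdot u v + wdot u' v.
Proof.
move=> su su' sv; apply: wdotP.
by apply: series_cvg_ext (series_cvgD (cvg_wdot su sv) (cvg_wdot su' sv)) => m; ring.
Qed.

Lemma wdotZl k u v : sq_summable u -> sq_summable v ->
  wdot (fun m => k * u m) v = k * wdot u v.
Proof.
move=> su sv; apply: wdotP.
by apply: series_cvg_ext (series_cvgZ k (cvg_wdot su sv)) => m; ring.
Qed.

Lemma sq_summable_sum (N : nat) (c : nat -> R) (e : nat -> nat -> R) :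
  (forall n, sq_summable (e n)) ->
  sq_summable (fun m => \sum_(n < N) c n * e n m).
Proof.
move=> se; elim: N => [|N IH].
  rewrite (_ : (fun m => _) = fun=> 0); first exact: sq_summable0.
  by apply/funext => m; rewrite big_ord0.
rewrite (_ : (fun m => _) = fun m => \sum_(n < N) c n * e n m + c N * e N m).
  by apply: sq_summableD => //; apply: sq_summableZ.
by apply/funext => m; rewrite big_ord_recr.
Qed.

Arguments sq_summable_sum N c {e}.

Lemma wdot_suml (N : nat) (c : nat -> R) (e : nat -> nat -> R) v :
  (forall n, sq_summable (e n)) -> sq_summable v ->
  wdot (fun m => \sum_(n < N) c n * e n m) v = \sum_(n < N) c n * wdot (e n) v.
Proof.
move=> se sv; elim: N => [|N IH].
  rewrite big_ord0; apply: wdotP; rewrite (_ : series _ = fun=> 0); first exact: cvg_cst.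
  by apply/funext => n; rewrite /series/= big1// => i _; rewrite big_ord0 mulr0 mul0r.
rewrite big_ord_recr/= -IH -(@wdotZl _ (e N) v (se N) sv) -wdotDl//.
- by congr wdot; apply/funext => m; rewrite big_ord_recr.
- exact: sq_summable_sum.
- exact: sq_summableZ.
Qed.

Lemma series_delta (f : nat -> R) n :
  series (fun m => (m == n)%:R * f m) @ \oo --> f n.
Proof.
apply: cvg_near_cst; near=> N.
have nN : (n < N)%N by near: N; exact: nbhs_infty_gt.
rewrite /series/= big_mkord (bigD1 (Ordinal nN))//= eqxx mul1r big1 ?addr0//.
by move=> i; rewrite -val_eqE/= => /negbTE ->; rewrite mul0r.
Unshelve. all: by end_near. Qed.

(** The unit sequence concentrated at [n]. *)
Definition delta (n m : nat) : R := (m == n)%:R.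

Lemma sq_summable_delta n : sq_summable (delta n).
Proof.
suff H : series (fun m => w m * delta n m ^+ 2) @ \oo --> w n by exact: cvgP H.
apply: series_cvg_ext (@series_delta w n) => m; rewrite /delta.
by case: eqP => _; rewrite ?(mul1r,mul0r,expr1n,mulr1,expr0n,mulr0).
Qed.

Lemma wdot_delta n v : wdot (delta n) v = w n * v n.
Proof.
apply: wdotP; have := @series_delta (fun m => w m * v m) n.
by apply: series_cvg_ext => m; rewrite /delta; ring.
Qed.

Arguments wdotZl k {u v}.

Lemma sqnormD u v : sq_summable u -> sq_summable v ->
  wdot (fun m => u m + v m) (fun m => u m + v m) =
  wdot u u + 2 * wdot u v + wdot v v.
Proof.
move=> su sv; have suv := sq_summableD su sv.
rewrite wdotDl// (wdotC u (fun m => _ + _)) (wdotC v (fun m => _ + _)).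
by rewrite !wdotDl// (wdotC v u); ring.
Qed.

Lemma sqnormD_le u v : sq_summable u -> sq_summable v ->
  wdot (fun m => u m + v m) (fun m => u m + v m) <=
  2 * wdot u u + 2 * wdot v v.
Proof.
move=> su sv; rewrite sqnormD//.
have sNv : sq_summable (fun m => -1 * v m) by exact: sq_summableZ.
have := wdot_ge0 (sq_summableD su sNv); rewrite sqnormD//.
rewrite (wdotZl (-1) sv sNv) (wdotC u (fun m => -1 * _)) (wdotC v (fun m => -1 * _)).
by rewrite !wdotZl// (wdotC v u); lra.
Qed.

End WeightedRealL2.
Arguments delta {R} n m.
Arguments sq_summable_sum {R w} w_ge0 N c {e}.

(** * Orthogonal systems and Fourier expansions *)

Section OrthogonalSystem.
Variables (R : realType) (w : nat -> R).
Hypothesis w_ge0 : forall m, 0 <= w m.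
Variables (e : nat -> nat -> R) (h : nat -> R).
Hypothesis h_gt0 : forall n, 0 < h n.
Hypothesis e_sq : forall n, sq_summable w (e n).
Hypothesis e_orth : forall n n', wdot w (e n) (e n') = h n * (n == n')%:R.
Implicit Types f g : nat -> R.

(** Fourier coefficient of [f] along [e n]; [h n] is the squared norm of [e n]. *)
Definition fcoef f n : R := wdot w f (e n) / h n.

(** What remains of [f] after the first [N] terms of its Fourier expansion. *)
Definition resid N f m : R := f m - \sum_(n < N) fcoef f n * e n m.

(** [f] is the sum in l2(w) of its Fourier expansion along the orthogonal
    system [e], i.e. [f] belongs to the closed linear span of [e]. *)
Definition expands f : Prop :=
  sq_summable w f /\ (fun N => wdot w (resid N f) (resid N f)) @ \oo --> 0.

Lemma residE N f :
  resid N f = fun m => f m + \sum_(n < N) - fcoef f n * e n m.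
Proof.
apply/funext => m; rewrite /resid -sumrN; congr (_ + _).
by apply: eq_bigr => i _; rewrite mulNr.
Qed.

Lemma sq_resid N f : sq_summable w f -> sq_summable w (resid N f).
Proof.
move=> sf; rewrite residE; apply: sq_summableD => //.
exact: (sq_summable_sum w_ge0 N (fun n => - fcoef f n)).
Qed.

Arguments sq_resid N {f}.

Lemma wdot_sum_e N (c : nat -> R) k :
  wdot w (fun m => \sum_(n < N) c n * e n m) (e k) =
  if (k < N)%N then c k * h k else 0.
Proof.
rewrite wdot_suml//; case: ltnP => kN.
  rewrite (bigD1 (Ordinal kN))//= e_orth eqxx mulr1 big1 ?addr0//.
  by move=> i; rewrite -val_eqE/= => /negbTE ik; rewrite e_orth ik mulr0n !mulr0.
rewrite big1// => i _; rewrite e_orth (_ : _ == _ = false) ?mulr0n ?mulr0//.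
by apply/negbTE; rewrite neq_ltn (leq_trans (ltn_ord i) kN).
Qed.

Lemma resid_orth N f k : sq_summable w f -> (k < N)%N ->
  wdot w (resid N f) (e k) = 0.
Proof.
move=> sf kN; rewrite residE wdotDl//; last first.
  exact: (sq_summable_sum w_ge0 N (fun n => - fcoef f n)).
rewrite (@wdot_sum_e N (fun n => - fcoef f n)) kN /fcoef mulNr divfK ?subrr//.
by rewrite gt_eqF.
Qed.

Lemma sqnorm_sum_e N (c : nat -> R) :
  wdot w (fun m => \sum_(n < N) c n * e n m) (fun m => \sum_(n < N) c n * e n m) =
  \sum_(n < N) c n ^+ 2 * h n.
Proof.
rewrite wdot_suml//; last exact: sq_summable_sum.
apply: eq_bigr => i _; rewrite wdotC wdot_sum_e ltn_ord; ring.
Qed.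

(** The partial Fourier sum is the best approximation of [f] by combinations
    of the first [N] vectors. *)
Lemma resid_best N f (c : nat -> R) : sq_summable w f ->
  wdot w (fun m => f m - \sum_(n < N) c n * e n m)
         (fun m => f m - \sum_(n < N) c n * e n m) =
  wdot w (resid N f) (resid N f) + \sum_(n < N) (fcoef f n - c n) ^+ 2 * h n.
Proof.
move=> sf; rewrite -(@sqnorm_sum_e N (fun n => fcoef f n - c n)).
rewrite (_ : (fun m => _) =
  fun m => resid N f m + \sum_(n < N) (fcoef f n - c n) * e n m); last first.
  apply/funext => m; rewrite /resid -addrA; congr (_ + _).
  rewrite -!sumrN -big_split; apply: eq_bigr => i _ /=; ring.
rewrite sqnormD//; [|exact: sq_resid|].
  2: exact: (sq_summable_sum w_ge0 N (fun n => fcoef f n - c n)).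
have -> : wdot w (resid N f) (fun m => \sum_(n < N) (fcoef f n - c n) * e n m) = 0.
  rewrite wdotC (@wdot_suml _ _ w_ge0 N (fun n => fcoef f n - c n))//.
    by rewrite big1// => i _; rewrite wdotC resid_orth ?mulr0.
  exact: sq_resid.
by rewrite mulr0 addr0.
Qed.

Lemma sqnorm_resid N f : sq_summable w f ->
  wdot w (resid N f) (resid N f) = wdot w f f - \sum_(n < N) fcoef f n ^+ 2 * h n.
Proof.
move=> sf; have := @resid_best N f (fun=> 0) sf.
rewrite (_ : (fun m => _) = f); last first.
  by apply/funext => m; rewrite big1 ?subr0// => i _; rewrite mul0r.
move=> ->; rewrite (eq_bigr (fun n : 'I_N => fcoef f n ^+ 2 * h n)) ?addrK//.
by move=> i _; rewrite subr0.
Qed.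

Lemma residD N f g : sq_summable w f -> sq_summable w g ->
  resid N (fun m => f m + g m) = fun m => resid N f m + resid N g m.
Proof.
move=> sf sg; apply/funext => m; rewrite /resid addrACA; congr (_ + _).
rewrite -!sumrN -big_split; apply: eq_bigr => i _ /=.
by rewrite /fcoef wdotDl//; ring.
Qed.

Lemma resid_ge0 N f : sq_summable w f -> 0 <= wdot w (resid N f) (resid N f).
Proof. by move=> sf; apply: wdot_ge0 => //; exact: sq_resid. Qed.

Lemma resid_mono N N' f : sq_summable w f -> (N <= N')%N ->
  wdot w (resid N' f) (resid N' f) <= wdot w (resid N f) (resid N f).
Proof.
move=> sf NN'; rewrite !sqnorm_resid// lerD2l lerN2.
rewrite -!(big_mkord xpredT (fun n => fcoef f n ^+ 2 * h n)).
rewrite (big_cat_nat (leq0n N) NN')/= lerDl sumr_ge0// => i _.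
by rewrite mulr_ge0 ?sqr_ge0// ltW.
Qed.

(** Approximation of [f] by arbitrary finite combinations of the [e n] suffices. *)
Lemma expands_of_approx f : sq_summable w f ->
  (forall eps : R, 0 < eps -> exists N (c : nat -> R),
     wdot w (fun m => f m - \sum_(n < N) c n * e n m)
            (fun m => f m - \sum_(n < N) c n * e n m) < eps) ->
  expands f.
Proof.
move=> sf fP; split=> //; apply/cvgrPdist_lt => eps eps0.
have [N [c]] := fP eps eps0; rewrite resid_best// => lt_eps.
near=> M; rewrite sub0r normrN ger0_norm ?resid_ge0//.
apply: le_lt_trans (_ : _ <= wdot w (resid N f) (resid N f)) _.
  by apply: resid_mono => //; near: M; exact: nbhs_infty_ge.
apply: le_lt_trans lt_eps; rewrite lerDl sumr_ge0// => i _.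
by rewrite mulr_ge0 ?sqr_ge0// ltW.
Unshelve. all: by end_near. Qed.

Lemma expandsD f g : expands f -> expands g ->
  expands (fun m => f m + g m).
Proof.
move=> [sf f0] [sg g0]; split; first exact: sq_summableD.
have fg0 : (fun N => 2 * wdot w (resid N f) (resid N f) +
    2 * wdot w (resid N g) (resid N g)) @ \oo --> (0 : R).
  rewrite (_ : 0 = 2 * 0 + 2 * 0); last by rewrite mulr0 addr0.
  by apply: cvgD; apply: cvgM => //; exact: cvg_cst.
apply: (squeeze_cvgr _ (@cvg_cst _ (0:R) _ _ _) fg0); apply: nearW => N.
rewrite resid_ge0/=; last exact: sq_summableD.
by rewrite residD//; apply: sqnormD_le => //; exact: sq_resid.
Qed.

Lemma expands_of_lim f : sq_summable w f ->
  (forall eps : R, 0 < eps -> exists2 g, expands g &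
     wdot w (fun m => f m - g m) (fun m => f m - g m) < eps) -> expands f.
Proof.
move=> sf fP; apply: expands_of_approx => // eps eps0.
have [g [sg g0] fg] : exists2 g, expands g &
     wdot w (fun m => f m - g m) (fun m => f m - g m) < eps / 4.
  by apply: fP; lra.
have [N gN] : exists N, wdot w (resid N g) (resid N g) < eps / 4.
  have /cvgrPdist_lt/(_ (eps / 4)) g0' := g0.
  have /g0' : 0 < eps / 4 by lra.
  case=> N _ /(_ N (leqnn N)) gN; exists N.
  by move: gN; rewrite /= sub0r normrN ger0_norm ?resid_ge0.
exists N, (fcoef g).
rewrite (_ : (fun m => _) = fun m => (f m - g m) + resid N g m); last first.
  by apply/funext => m; rewrite /resid; ring.
have sfg : sq_summable w (fun m => f m - g m).
  rewrite (_ : (fun m => _) = fun m => f m + -1 * g m); last first.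
    by apply/funext => m; ring.
  by apply: sq_summableD => //; exact: sq_summableZ.
apply: le_lt_trans (sqnormD_le w_ge0 sfg (sq_resid N sg)) _.
by lra.
Qed.

Lemma parseval_sq f : expands f ->
  series (fun n => wdot w f (e n) ^+ 2 / h n) @ \oo --> wdot w f f.
Proof.
move=> [sf f0].
have : (fun N => wdot w f f - wdot w (resid N f) (resid N f)) @ \oo --> wdot w f f - 0.
  by apply: cvgB => //; exact: cvg_cst.
rewrite subr0; apply: cvg_seq_ext => N /=.
rewrite sqnorm_resid// opprB addrC subrK /series/= big_mkord; apply: eq_bigr => i _.
by rewrite /fcoef; field; rewrite gt_eqF.
Qed.

(** Polarised Parseval identity. *)
Lemma parseval f g : expands f -> expands g ->
  series (fun n => wdot w f (e n) * wdot w g (e n) / h n) @ \oo --> wdot w f g.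
Proof.
move=> cf cg; have := parseval_sq (expandsD cf cg).
have [[sf _] [sg _]] := (cf, cg) => cfg.
have := series_cvgZ 2^-1
  (series_cvgB (series_cvgB cfg (parseval_sq cf)) (parseval_sq cg)).
rewrite sqnormD// (_ : _ * (_ - _ - _) = wdot w f g); last by field.
apply: series_cvg_ext => n.
by rewrite wdotDl//; field; rewrite gt_eqF.
Qed.

Lemma expands_of_parseval f : sq_summable w f ->
  series (fun n => wdot w f (e n) ^+ 2 / h n) @ \oo --> wdot w f f ->
  expands f.
Proof.
move=> sf fP; split=> //.
have : (fun N => wdot w f f - series (fun n => wdot w f (e n) ^+ 2 / h n) N) @ \oo -->
    wdot w f f - wdot w f f by apply: cvgB => //; exact: cvg_cst.
rewrite subrr; apply: cvg_seq_ext => N /=.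
rewrite sqnorm_resid//; congr (_ - _); rewrite /series/= big_mkord; apply: eq_bigr => i _.
by rewrite /fcoef; field; rewrite gt_eqF.
Qed.

Lemma expandsZ k f : expands f -> expands (fun m => k * f m).
Proof.
move=> cf; have [sf _] := cf.
apply: expands_of_parseval; first exact: sq_summableZ.
rewrite (_ : wdot w _ _ = k ^+ 2 * wdot w f f); last first.
  rewrite wdotZl//; last exact: sq_summableZ.
  by rewrite wdotC wdotZl// mulrA.
apply: series_cvg_ext (series_cvgZ (k ^+ 2) (parseval_sq cf)) => n.
by rewrite wdotZl// exprMn mulrA.
Qed.

(** A system is complete as soon as its closed span contains the unit
    sequences, finitely supported sequences being dense in l2(w). *)
Lemma expands_total : (forall n, expands (delta n)) ->
  forall f, sq_summable w f -> expands f.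
Proof.
move=> cdelta f sf; apply: expands_of_lim => // eps eps0.
have trunc_closed N : expands (fun m => \sum_(n < N) f n * delta n m).
  elim: N => [|N IH].
    rewrite (_ : (fun m => _) = fun m => 0 * delta 0 m); first exact: expandsZ.
    by apply/funext => m; rewrite big_ord0 mul0r.
  rewrite (_ : (fun m => _) = fun m => \sum_(n < N) f n * delta n m + f N * delta N m).
    exact: (expandsD IH (expandsZ (f N) (cdelta N))).
  by apply/funext => m; rewrite big_ord_recr.
have truncE N m : \sum_(n < N) f n * delta n m = if (m < N)%N then f m else 0.
  case: ltnP => mN.
    rewrite (bigD1 (Ordinal mN))//= /delta eqxx mulr1 big1 ?addr0// => i.
    by rewrite -val_eqE eq_sym/= => /negbTE ->; rewrite mulr0.
  rewrite big1// => i _; rewrite /delta (_ : _ == _ = false) ?mulr0//.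
  by rewrite eq_sym; apply/negbTE; rewrite neq_ltn (leq_trans (ltn_ord i) mN).
have [N _ /(_ N (leqnn N)) /= NP] : \forall N \near \oo,
    `|wdot w f f - series (fun m => w m * f m ^+ 2) N| < eps.
  by move/cvgrPdist_lt: (cvg_sqnorm w_ge0 sf); apply.
exists (fun m => \sum_(n < N) f n * delta n m) => //.
suff -> : wdot w (fun m => f m - \sum_(n < N) f n * delta n m)
  (fun m => f m - \sum_(n < N) f n * delta n m) =
  wdot w f f - series (fun m => w m * f m ^+ 2) N.
  by apply: le_lt_trans NP; rewrite ler_norm.
apply: wdotP.
have : (fun M => series (fun m => w m * f m ^+ 2) M -
    series (fun m => w m * f m ^+ 2) N) @ \oo -->
    wdot w f f - series (fun m => w m * f m ^+ 2) N.
  by apply: cvgB; [exact: cvg_sqnorm|exact: cvg_cst].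
apply: cvg_trans; apply: near_eq_cvg; near=> M.
have NM : (N <= M)%N by near: M; exact: nbhs_infty_ge.
rewrite /series/= !(big_cat_nat (leq0n N) NM)/=.
rewrite (addrC (\sum_(0 <= i < N) w i * f i ^+ 2)) addrK.
have -> : \sum_(0 <= i < N) w i * (f i - \sum_(n < N) f n * delta n i) *
     (f i - \sum_(n < N) f n * delta n i) = 0.
  by rewrite big_nat big1// => i /andP[_ iN]; rewrite truncE iN subrr mulr0.
rewrite add0r; apply: eq_big_nat => i /andP[Ni _]; rewrite truncE ltnNge Ni/= subr0.
by ring.
Unshelve. all: by end_near. Qed.

End OrthogonalSystem.
Arguments sq_resid {R w} w_ge0 {e} h e_sq N {f}.

(** * q-Pochhammer symbols, q-binomial theorem, q-Chu-Vandermonde sum *)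

Section QPochhammer.
Variables (R : realType) (q : R).
Hypotheses (q_gt0 : 0 < q) (q_lt1 : q < 1).
Implicit Types (x z beta : R) (k m n : nat).

Let q_neq0 : q != 0. Proof. by rewrite gt_eqF. Qed.

Lemma qpoch0 x : qpoch x q 0 = 1.
Proof. by rewrite /qpoch big_ord0. Qed.

Lemma qpochS x k : qpoch x q k.+1 = qpoch x q k * (1 - x * q ^+ k).
Proof. by rewrite /qpoch big_ord_recr. Qed.

Lemma qpochSl x k : qpoch x q k.+1 = (1 - x) * qpoch (x * q) q k.
Proof.
rewrite /qpoch big_ord_recl expr0 mulr1; congr (_ * _).
by apply: eq_bigr => i _; rewrite /= exprS mulrA.
Qed.

Lemma qpochD x m n : qpoch x q (m + n) = qpoch x q m * qpoch (x * q ^+ m) q n.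
Proof.
elim: n => [|n IH]; first by rewrite addn0 qpoch0 mulr1.
by rewrite addnS !qpochS IH -!mulrA -exprD.
Qed.

Lemma qpoch_0l k : qpoch 0 q k = 1.
Proof. by rewrite /qpoch big1// => i _; rewrite mul0r subr0. Qed.

Lemma qX_le1 n : q ^+ n <= 1.
Proof. by rewrite exprn_ile1// ltW. Qed.

Lemma mul_qX_lt1 x n : x < 1 -> x * q ^+ n < 1.
Proof.
move=> x1; have [x0|x0] := ltP x 0.
  by apply: lt_trans ltr01; rewrite pmulr_llt0// exprn_gt0.
by apply: le_lt_trans x1; rewrite ler_piMr// qX_le1.
Qed.

Lemma qpoch_gt0 x k : x < 1 -> 0 < qpoch x q k.
Proof. by move=> x1; apply: prodr_gt0 => i _; rewrite subr_gt0 mul_qX_lt1. Qed.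

Lemma qpoch_neq0 x k : x < 1 -> qpoch x q k != 0.
Proof. by move=> x1; rewrite gt_eqF// qpoch_gt0. Qed.

Lemma cvg_qX : (fun n => q ^+ n) @ \oo --> (0 : R).
Proof. by apply: cvg_expr; rewrite gtr0_norm. Qed.

(** Ratio test, for nonnegative terms. *)
Lemma ratio_test (u : nat -> R) (r : R) : (forall n, 0 <= u n) -> r < 1 ->
  (\forall n \near \oo, u n.+1 <= r * u n) -> cvgn (series u).
Proof.
move=> u0 r1 [N _ uN].
(* From rank N on, the partial sum plus u_n / (1 - r) is nonincreasing. *)
have uS n : (N <= n)%N ->
    series u n + u n / (1 - r) <= series u N + u N / (1 - r).
  elim: n => [|n IH]; first by rewrite leqn0 => /eqP ->.
  rewrite leq_eqVlt => /orP[/eqP->//|]; rewrite ltnS => Nn.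
  apply: le_trans (IH Nn); rewrite seriesSr -addrA lerD2l.
  rewrite [leRHS](_ : _ = u n + (r * u n) / (1 - r)); last by field; lra.
  by rewrite lerD2l ler_pM2r ?invr_gt0 ?subr_gt0// uN.
apply: nondecreasing_is_cvgn; first exact: nondecreasing_series.
exists (series u N + u N / (1 - r)) => _ [n _ <-].
have [Nn|/ltnW nN] := leqP N n.
  apply: le_trans (uS n Nn); rewrite lerDl divr_ge0// subr_ge0 ltW//.
apply: (@le_trans _ _ (series u N)); first exact: nondecreasing_series.
by rewrite lerDl divr_ge0// subr_ge0 ltW.
Qed.

(** General term of the q-binomial series 1phi0(beta; q, z). *)
Definition qbin_term beta z n : R := qpoch beta q n / qpoch q q n * z ^+ n.

Lemma qbin_term0 beta z : qbin_term beta z 0 = 1.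
Proof. by rewrite /qbin_term !qpoch0 expr0 divr1 mulr1. Qed.

Lemma qbin_term_ge0 beta z n : beta < 1 -> 0 <= z -> 0 <= qbin_term beta z n.
Proof.
move=> b1 z0; rewrite mulr_ge0 ?exprn_ge0// divr_ge0// ltW// qpoch_gt0//.
Qed.

Lemma qbin_termS beta z n :
  qbin_term beta z n.+1 * (1 - q ^+ n.+1) =
  z * (1 - beta * q ^+ n) * qbin_term beta z n.
Proof.
have n1 : 1 - q * q ^+ n != 0 by rewrite gt_eqF// subr_gt0 mul_qX_lt1.
by rewrite /qbin_term !qpochS !exprS; field; rewrite qpoch_neq0.
Qed.

Lemma cvg_qbin beta z : beta < 1 -> 0 <= z -> z < 1 ->
  cvgn (series (qbin_term beta z)).
Proof.
move=> b1 z0 z1; set r := (1 + z) / 2.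
apply: (@ratio_test _ r); [by move=> n; exact: qbin_term_ge0|by rewrite /r; lra|].
have : (fun n => (r * q - z * beta) * q ^+ n) @ \oo --> (r * q - z * beta) * 0.
  by apply: cvgM; [exact: cvg_cst|exact: cvg_qX].
rewrite mulr0 => /cvgrPdist_lt/(_ (r - z)) H.
have /H {}H : 0 < r - z by rewrite /r; lra.
near=> n.
have : `|0 - (r * q - z * beta) * q ^+ n| < r - z by near: n; exact: H.
rewrite sub0r normrN => /(le_lt_trans (ler_norm _)) lt_rz.
have q1 : 0 < 1 - q ^+ n.+1 by rewrite subr_gt0 exprn_ilt1// ltW.
rewrite -(ler_pM2r q1) qbin_termS.
rewrite [r * _ * _]mulrAC ler_wpM2r ?qbin_term_ge0//.
rewrite exprS; nra.
Unshelve. all: by end_near. Qed.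

(** Sum of the q-binomial series. *)
Definition qbinF beta z : R := limn (series (qbin_term beta z)).

Lemma qbinF_cvg beta z : beta < 1 -> 0 <= z -> z < 1 ->
  series (qbin_term beta z) @ \oo --> qbinF beta z.
Proof. by move=> *; exact: cvg_qbin. Qed.

Lemma qbinF_ge1 beta z : beta < 1 -> 0 <= z -> z < 1 -> 1 <= qbinF beta z.
Proof.
move=> b1 z0 z1; apply: limr_ge; first exact: cvg_qbin.
near=> n; have n0 : (0 < n)%N by near: n; exact: nbhs_infty_gt.
rewrite /series/= -(prednK n0) big_nat_recl//.
rewrite qbin_term0 lerDl sumr_ge0// => i _.
exact: qbin_term_ge0.
Unshelve. all: by end_near. Qed.

(** Functional equation of the q-binomial series, whose iteration gives the
    infinite products. *)
Lemma qbinF_fun_eq beta z : beta < 1 -> 0 <= z -> z < 1 ->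
  (1 - z) * qbinF beta z = (1 - beta * z) * qbinF beta (z * q).
Proof.
move=> b1 z0 z1.
have zq0 : 0 <= z * q by rewrite mulr_ge0// ltW.
have zq1 : z * q < 1 by rewrite -[q]expr1 mul_qX_lt1.
have cF := qbinF_cvg b1 z0 z1; have cFq := qbinF_cvg b1 zq0 zq1.
have H1 := series_cvgB cF cFq.
have H2 := series_cvgB (series_cvgZ z cF) (series_cvgZ (beta * z) cFq).
suff /eqP : qbinF beta z - qbinF beta (z * q) =
            z * qbinF beta z - beta * z * qbinF beta (z * q).
  by move=> /eqP H; rewrite !mulrBl !mul1r; move: H; lra.
rewrite -(cvg_lim (@Rhausdorff R) H1); apply: (cvg_lim (@Rhausdorff R)).
rewrite -cvg_shiftS; apply: cvg_seq_ext H2 => n.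
rewrite /series/= big_nat_recl// !qbin_term0 subrr add0r.
apply: eq_bigr => i _.
have zqE k : qbin_term beta (z * q) k = qbin_term beta z k * q ^+ k.
  by rewrite /qbin_term exprMn mulrA.
have := qbin_termS beta z i; rewrite !zqE; lra.
Qed.

Lemma qbinF_iter beta z N : beta < 1 -> 0 <= z -> z < 1 ->
  qpoch z q N * qbinF beta z = qpoch (beta * z) q N * qbinF beta (z * q ^+ N).
Proof.
move=> b1 z0 z1; elim: N => [|N IH]; first by rewrite !qpoch0 expr0 mulr1.
rewrite !qpochS mulrAC IH mulrAC -mulrA.
rewrite [_ * (1 - _)]mulrC qbinF_fun_eq//; last 2 first.
- by rewrite mulr_ge0// exprn_ge0// ltW.
- exact: mul_qX_lt1.
by rewrite -(mulrA z) -exprSr; ring.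
Qed.

Lemma qbinF_cvg1 beta z : beta < 1 -> 0 <= z -> z < 1 ->
  (fun N => qbinF beta (z * q ^+ N)) @ \oo --> (1 : R).
Proof.
move=> b1 z0 z1.
have zN0 N : 0 <= z * q ^+ N by rewrite mulr_ge0// exprn_ge0// ltW.
have zN1 N : z * q ^+ N < 1 by exact: mul_qX_lt1.
have H : (fun N => q ^+ N * qbinF beta z + (1 - q ^+ N)) @ \oo -->
    0 * qbinF beta z + (1 - 0).
  apply: cvgD; first by apply: cvgM; [exact: cvg_qX|exact: cvg_cst].
  by apply: cvgB; [exact: cvg_cst|exact: cvg_qX].
rewrite mul0r add0r subr0 in H.
apply: (squeeze_cvgr _ (@cvg_cst _ (1:R) _ _ _) H); apply: nearW => N.
rewrite qbinF_ge1//=.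
have H2 := series_cvgD (series_cvgZ (q ^+ N) (qbinF_cvg b1 z0 z1))
                       (@series_delta R (fun=> 1 - q ^+ N) 0).
rewrite -(cvg_lim (@Rhausdorff R) H2); apply: lim_series_le.
- exact: cvg_qbin.
- exact: cvgP H2.
move=> n; have -> : qbin_term beta (z * q ^+ N) n = qbin_term beta z n * q ^+ (N * n).
  by rewrite /qbin_term exprMn mulrA exprM.
have t0 := qbin_term_ge0 n b1 z0.
case: n t0 => [|n] t0.
  by rewrite muln0 eqxx mul1r expr0 mulr1 qbin_term0; lra.
rewrite mul0r addr0 mulrC ler_wpM2r// mulnS exprD ler_piMr ?qX_le1//.
by rewrite exprn_ge0// ltW.
Qed.

Lemma cvg_qpoch01 z : 0 <= z -> z < 1 -> qpoch z q @ \oo --> (qbinF 0 z)^-1.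
Proof.
move=> z0 z1; have F1 := @qbinF_cvg1 0 z ltr01 z0 z1.
have F0 : qbinF 0 z != 0 by rewrite gt_eqF// (lt_le_trans ltr01)// qbinF_ge1.
have : (fun N => qbinF 0 (z * q ^+ N) / qbinF 0 z) @ \oo --> 1 / qbinF 0 z.
  by apply: cvgM => //; exact: cvg_cst.
rewrite div1r; apply: cvg_seq_ext => N.
have := @qbinF_iter 0 z N ltr01 z0 z1; rewrite mul0r qpoch_0l mul1r => <-.
by rewrite mulfK.
Qed.

Lemma cvg_qpoch_beta beta z : beta < 1 -> 0 <= z -> z < 1 ->
  qpoch (beta * z) q @ \oo --> qbinF beta z / qbinF 0 z.
Proof.
move=> b1 z0 z1; have F1 := @qbinF_cvg1 beta z b1 z0 z1.
have : (fun N => qpoch z q N * qbinF beta z / qbinF beta (z * q ^+ N)) @ \oo -->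
    (qbinF 0 z)^-1 * qbinF beta z / 1.
  apply: cvgM; last by apply: cvgV => //; exact: oner_neq0.
  by apply: cvgM; [exact: cvg_qpoch01|exact: cvg_cst].
rewrite divr1 [_^-1 * _]mulrC; apply: cvg_seq_ext => N.
rewrite qbinF_iter// mulfK// gt_eqF// (lt_le_trans ltr01)// qbinF_ge1//.
  by rewrite mulr_ge0// exprn_ge0// ltW.
exact: mul_qX_lt1.
Qed.

(** Convergence of the infinite product is read off the q-binomial series. *)
Lemma cvg_qpoch x : x < 1 -> qpoch x q @ \oo --> qpoch_inf x q.
Proof.
move=> x1; suff [l H] : exists l : R, qpoch x q @ \oo --> l by apply: cvgP H.
(* For x < 0, write x = beta z with beta = 2 x < 0 and z = 1/2. *)
have [x0|x0] := leP 0 x; first by eexists; exact: cvg_qpoch01.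
have := @cvg_qpoch_beta (2 * x) 2^-1; rewrite mulrAC divff// mul1r => H.
by eexists; apply: H; lra.
Qed.

Lemma qpoch_inf_gt0 x : x < 1 -> 0 < qpoch_inf x q.
Proof.
move=> x1; have qlim l : qpoch x q @ \oo --> l -> qpoch_inf x q = l.
  by move=> /(cvg_lim (@Rhausdorff R)).
have Fgt0 beta z : beta < 1 -> 0 <= z -> z < 1 -> 0 < qbinF beta z.
  by move=> *; rewrite (lt_le_trans ltr01)// qbinF_ge1.
have [x0|x0] := leP 0 x.
  by rewrite (qlim _ (cvg_qpoch01 x0 x1)) invr_gt0 Fgt0.
have := @cvg_qpoch_beta (2 * x) 2^-1; rewrite mulrAC divff// mul1r => H.
rewrite (qlim _ (H _ _ _)); [|lra..].
by rewrite divr_gt0// Fgt0//; lra.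
Qed.

Lemma qpoch_infD x k : x < 1 ->
  qpoch_inf x q = qpoch x q k * qpoch_inf (x * q ^+ k) q.
Proof.
move=> x1; apply: (cvg_lim (@Rhausdorff R)).
rewrite -(cvg_shiftn k).
have : (fun n => qpoch x q k * qpoch (x * q ^+ k) q n) @ \oo -->
       qpoch x q k * qpoch_inf (x * q ^+ k) q.
  by apply: cvgM; [exact: cvg_cst|exact/cvg_qpoch/mul_qX_lt1].
by apply: cvg_seq_ext => n /=; rewrite addnC qpochD.
Qed.

(** q-binomial theorem. *)
Theorem q_binomial beta z : beta < 1 -> 0 <= z -> z < 1 ->
  series (fun n => qpoch beta q n / qpoch q q n * z ^+ n) @ \oo -->
  qpoch_inf (beta * z) q / qpoch_inf z q.
Proof.
move=> b1 z0 z1.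
have F0 : qbinF 0 z != 0 by rewrite gt_eqF// (lt_le_trans ltr01)// qbinF_ge1.
have -> : qpoch_inf z q = (qbinF 0 z)^-1.
  by apply: (cvg_lim (@Rhausdorff R)); exact: cvg_qpoch01.
have -> : qpoch_inf (beta * z) q = qbinF beta z / qbinF 0 z.
  by apply: (cvg_lim (@Rhausdorff R)); exact: cvg_qpoch_beta.
by rewrite invrK divfK//; exact: qbinF_cvg.
Qed.

(** For X = q^m this is (-1)^k q^(k(k-1)/2) times the Gaussian binomial
    coefficient of m and k. *)
Definition gcoef (X : R) k : R := \prod_(j < k) ((X - q ^+ j) / (1 - q ^+ j.+1)).

Lemma gcoefS X k : gcoef X k.+1 = gcoef X k * ((X - q ^+ k) / (1 - q ^+ k.+1)).
Proof. by rewrite /gcoef big_ord_recr. Qed.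

(** q-Pascal rule. *)
Lemma gcoef_pascal X k : gcoef (X * q) k.+1 = gcoef X k.+1 - X * gcoef X k.
Proof.
have nz j : 1 - q ^+ j.+1 != 0.
  by rewrite subr_eq0 eq_sym lt_eqF// exprn_ilt1// ltW.
elim: k => [|k IH].
  have := nz 0; rewrite expr1 => nz0.
  by rewrite !gcoefS /gcoef !big_ord0 !expr0 !expr1; field.
rewrite [LHS]gcoefS IH !gcoefS.
have := nz k.+1; have := nz k; rewrite !exprS; set y := q ^+ k => n1 n2.
by field; rewrite n1 n2.
Qed.

(** q-Chu-Vandermonde summation of 2phi1(q^-m, B; B t; q, t q^m), multiplied by
    (B t; q)_m so that neither B nor the denominators need be nonzero. *)
Lemma q_chu_vandermonde m t B :
  \sum_(k < m.+1) gcoef (q ^+ m) k * t ^+ k * qpoch B q k *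
     qpoch (B * t * q ^+ k) q (m - k) = qpoch t q m.
Proof.
elim: m t B => [|m IH] t B.
  by rewrite big_ord1 /gcoef big_ord0 !qpoch0 !mulr1.
pose S B := \sum_(k < m.+1) gcoef (q ^+ m) k * t ^+ k * qpoch B q k *
     qpoch (B * t * q ^+ k) q (m - k).
have g0 : gcoef (q ^+ m) m.+1 = 0 by rewrite gcoefS subrr mul0r mulr0.
have -> : \sum_(k < m.+2) gcoef (q ^+ m.+1) k * t ^+ k * qpoch B q k *
     qpoch (B * t * q ^+ k) q (m.+1 - k) =
   \sum_(k < m.+2) gcoef (q ^+ m) k * t ^+ k * qpoch B q k *
     qpoch (B * t * q ^+ k) q (m.+1 - k) -
   \sum_(k < m.+1) q ^+ m * gcoef (q ^+ m) k * t ^+ k.+1 * qpoch B q k.+1 *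
     qpoch (B * t * q ^+ k.+1) q (m - k).
  rewrite big_ord_recl [in RHS]big_ord_recl -addrA; congr (_ + _).
    by rewrite /gcoef !big_ord0.
  rewrite -sumrN -big_split; apply: eq_bigr => k _.
  by rewrite lift0 subSS exprSr gcoef_pascal /=; ring.
have -> : \sum_(k < m.+2) gcoef (q ^+ m) k * t ^+ k * qpoch B q k *
     qpoch (B * t * q ^+ k) q (m.+1 - k) = (1 - B * t * q ^+ m) * S B.
  rewrite big_ord_recr/= g0 !mul0r addr0 mulr_sumr; apply: eq_bigr => k _.
  have km : (k <= m)%N by rewrite -ltnS.
  by rewrite subSn// qpochS -[_ * q ^+ k * _]mulrA -exprD subnKC//; ring.
have -> : \sum_(k < m.+1) q ^+ m * gcoef (q ^+ m) k * t ^+ k.+1 * qpoch B q k.+1 *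
     qpoch (B * t * q ^+ k.+1) q (m - k) = q ^+ m * t * (1 - B) * S (B * q).
  rewrite mulr_sumr; apply: eq_bigr => k _.
  rewrite qpochSl (_ : B * t * q ^+ k.+1 = B * q * t * q ^+ k); last by rewrite exprS; ring.
  by rewrite exprS; ring.
(* By induction both sums are (t; q)_m, independently of B. *)
by rewrite /S !IH qpochS; ring.
Qed.

End QPochhammer.

(** * Little q-Jacobi polynomials and their duals *)

Section LittleQJacobi.
Variables (R : realType) (q a b : R).
Hypotheses (q_gt0 : 0 < q) (q_lt1 : q < 1).
Hypotheses (a_gt0 : 0 < a) (aq_lt1 : a * q < 1) (bq_lt1 : b * q < 1).
Implicit Types (x z beta : R) (k m n l : nat).

Let q_neq0 : q != 0. Proof. by rewrite gt_eqF. Qed.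
Let q_ge0 : 0 <= q. Proof. exact: ltW. Qed.
Let a_neq0 : a != 0. Proof. by rewrite gt_eqF. Qed.
Let qX_neq0 n : q ^+ n != 0. Proof. by rewrite expf_neq0. Qed.
Let qX_gt0 n : 0 < q ^+ n. Proof. by rewrite exprn_gt0. Qed.
Let aq_ge0 : 0 <= a * q. Proof. by rewrite mulr_ge0 ?ltW. Qed.

Lemma abq2_lt1 : a * b * q ^+ 2 < 1.
Proof.
have -> : a * b * q ^+ 2 = (b * q) * (a * q) by ring.
have aq0 : 0 < a * q by rewrite mulr_gt0.
have [bq0|bq0] := leP 0 (b * q); last by nra.
by rewrite mulr_ilt1 // ltW.
Qed.

Lemma abqX_lt1 n : (2 <= n)%N -> a * b * q ^+ n < 1.
Proof.
by move=> n2; rewrite -(subnKC n2) exprD mulrA mul_qX_lt1// abq2_lt1.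
Qed.

(** The basis (1 - x)(1 - x q^-1)...(1 - x q^(1-k)) of polynomials in x, which
    vanishes at x = q^n for n < k. *)
Definition falling k x : R := \prod_(j < k) (1 - x * q ^- j).

Lemma fallingS k x : falling k.+1 x = falling k x * (1 - x * q ^- k).
Proof. by rewrite /falling big_ord_recr. Qed.

Lemma falling_eq0 k n : (n < k)%N -> falling k (q ^+ n) = 0.
Proof.
move=> nk; rewrite /falling (bigD1 (Ordinal nk))//= divff// subrr mul0r//.
Qed.

Lemma falling_ge0_le1 k n : (k <= n)%N -> 0 <= falling k (q ^+ n) <= 1.
Proof.
move=> kn; have fk (i : 'I_k) : 0 <= 1 - q ^+ n * q ^- i <= 1.
  have -> : (n = n - i + i)%N by rewrite subnK// (leq_trans (ltnW (ltn_ord i))).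
  rewrite exprD mulfK//; have := qX_gt0 (n - i); have := qX_le1 q_gt0 q_lt1 (n - i).
  by lra.
rewrite prodr_ge0 ?prodr_ile1// => i _; by case/andP: (fk i).
Qed.

Lemma falling_qpoch k n : falling k (q ^+ (n + k)) * qpoch q q n = qpoch q q (n + k).
Proof.
elim: k n => [|k IH] n; first by rewrite addn0 /falling big_ord0 mul1r.
rewrite fallingS -addSnnS -IH qpochS -mulrA [_ * qpoch _ _ _]mulrC; congr (_ * (_ * _)).
by rewrite exprD mulfK// exprS.
Qed.

Lemma series_shift (u : nat -> R) k (s : R) : (forall n, (n < k)%N -> u n = 0) ->
  series (fun n => u (n + k)%N) @ \oo --> s -> series u @ \oo --> s.
Proof.
move=> u0 us; rewrite -(cvg_shiftn k); apply: cvg_seq_ext us => n /=.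
rewrite /series/= (big_cat_nat (leq0n k) (leq_addl n k))/=.
have -> : \sum_(0 <= i < k) u i = 0.
  by rewrite big_nat big1// => i /andP[_ /u0].
by rewrite add0r; have := @big_addn R 0 +%R 0 (n + k) k xpredT u; rewrite add0n addnK.
Qed.

(** Termwise, the factor [falling] shifts the q-binomial series by k. *)
Lemma series_falling beta z k : beta < 1 -> 0 <= z -> z < 1 ->
  series (fun n => qpoch beta q n / qpoch q q n * z ^+ n * falling k (q ^+ n)) @ \oo -->
  qpoch beta q k * z ^+ k * (qpoch_inf (beta * z * q ^+ k) q / qpoch_inf z q).
Proof.
move=> b1 z0 z1; apply: (@series_shift _ k).
  by move=> n nk; rewrite falling_eq0 ?mulr0.
have := series_cvgZ (qpoch beta q k * z ^+ k)
  (q_binomial q_gt0 q_lt1 (mul_qX_lt1 q_gt0 q_lt1 k b1) z0 z1).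
rewrite [beta * q ^+ k * z]mulrAC; apply: series_cvg_ext => n.
have F0 : falling k (q ^+ (n + k)) != 0.
  rewrite /falling; apply/prodf_neq0 => i _.
  have -> : (n + k = i + (n + (k - i)))%N by rewrite addnCA subnKC// ltnW.
  rewrite exprD mulrAC divff// mul1r gt_eqF//.
  by rewrite subr_gt0 exprn_ilt1// -lt0n addn_gt0 subn_gt0 ltn_ord orbT.
rewrite -(falling_qpoch k n); move: F0; set F := falling k _ => F0.
rewrite [(n + k)%N]addnC qpochD exprD; field.
by rewrite F0 qpoch_neq0.
Qed.

(** Coefficients of the little q-Jacobi polynomial in the basis [falling]. *)
Definition jacobi_coef m k : R :=
  qpoch (q ^- m) q k * qpoch (a * b * q ^+ m.+1) q k /
  (qpoch (b * q) q k * qpoch q q k * a ^+ k).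

(** The little q-Jacobi polynomial of degree m, normalised to take the value 1
    at x = 1. Its value at x = q^n is the dual polynomial of degree n at mu(m). *)
Definition little_jacobi m x : R := \sum_(k < m.+1) jacobi_coef m k * falling k x.

(** Weight of the little q-Jacobi polynomials at x = q^n. *)
Definition jweight n : R := qpoch (b * q) q n / qpoch q q n * (a * q) ^+ n.

Lemma jweight_gt0 n : 0 < jweight n.
Proof.
by rewrite mulr_gt0 ?divr_gt0 ?qpoch_gt0// exprn_gt0// mulr_gt0.
Qed.

Lemma qpoch_gcoef m k :
  qpoch (q ^- m) q k * (q ^+ m) ^+ k / qpoch q q k = gcoef q (q ^+ m) k.
Proof.
elim: k => [|k IH]; first by rewrite !qpoch0 expr0 /gcoef big_ord0 mulr1 divr1.
rewrite gcoefS -IH !qpochS [(q ^+ m) ^+ k.+1]exprS [q ^+ k.+1]exprS; field.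
by rewrite qX_neq0 qpoch_neq0// gt_eqF// subr_gt0 mul_qX_lt1.
Qed.

(** The l-th moment against the m-th little q-Jacobi polynomial, for l <= m. The
    last factor vanishes for l < m. *)
Lemma jacobi_moment m l : (l <= m)%N ->
  series (fun n => jweight n * little_jacobi m (q ^+ n) * (q ^+ n) ^+ l) @ \oo -->
  qpoch_inf (a * b * q ^+ (l + m).+2) q / qpoch_inf (a * q ^+ l.+1) q
  * qpoch (q ^+ l.+1 / q ^+ m) q m.
Proof.
move=> lm; set z := a * q ^+ l.+1; set t := q ^+ l.+1 / q ^+ m.
(* Parameters of the q-Chu-Vandermonde sum: t q^m = q^(l+1), B t = a b q^(l+2). *)
set B := a * b * q ^+ m.+1.
have z0 : 0 <= z by rewrite mulr_ge0 ?ltW.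
have z1 : z < 1 by rewrite /z exprS mulrA mul_qX_lt1.
have tE : q ^+ l.+1 = t * q ^+ m by rewrite divfK.
have BtE : B * t = a * b * q ^+ l.+2.
  by rewrite /B /t exprS [q ^+ l.+2]exprS; field.
have H (N : nat) : series (fun n => \sum_(k < N) jacobi_coef m k *
     (qpoch (b * q) q n / qpoch q q n * z ^+ n * falling k (q ^+ n))) @ \oo -->
   \sum_(k < N) jacobi_coef m k * (qpoch (b * q) q k * z ^+ k *
      (qpoch_inf (b * q * z * q ^+ k) q / qpoch_inf z q)).
  elim: N => [|N IH].
    rewrite big_ord0 (_ : series _ = fun=> 0); first exact: cvg_cst.
    by apply/funext => n; rewrite /series/= big1// => i _; rewrite big_ord0.
  rewrite big_ord_recr/=.
  have := series_cvgD IH (series_cvgZ (jacobi_coef m N) (@series_falling _ _ N bq_lt1 z0 z1)).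
  by apply: series_cvg_ext => n; rewrite [RHS]big_ord_recr.
have := H m.+1.
have -> : \sum_(k < m.+1) jacobi_coef m k * (qpoch (b * q) q k * z ^+ k *
      (qpoch_inf (b * q * z * q ^+ k) q / qpoch_inf z q)) =
   qpoch_inf (a * b * q ^+ (l + m).+2) q / qpoch_inf z q * qpoch t q m.
  rewrite -(q_chu_vandermonde q_gt0 q_lt1 m t B) mulr_sumr; apply: eq_bigr => k _.
  have km : (k <= m)%N by rewrite -ltnS.
  have -> : b * q * z * q ^+ k = a * b * q ^+ (l.+2 + k).
    by rewrite /z exprD !exprS; ring.
  rewrite (@qpoch_infD _ _ _ _ (a * b * q ^+ (l.+2 + k)) (m - k))//;
    last exact: abqX_lt1.
  rewrite -[a * b * _ * q ^+ (m - k)]mulrA -exprD -addnA subnKC// !addSn.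
  rewrite BtE -[a * b * _ * q ^+ k]mulrA -exprD !addSn.
  rewrite -qpoch_gcoef /jacobi_coef /z tE exprMn exprMn -/B; field.
  by rewrite !qpoch_neq0// expf_neq0// andbT gt_eqF// qpoch_inf_gt0// -tE.
apply: series_cvg_ext => n.
rewrite /jweight /little_jacobi mulr_sumr mulr_suml; apply: eq_bigr => k _.
have -> : z ^+ n = (a * q) ^+ n * (q ^+ n) ^+ l.
  by rewrite /z exprS mulrA exprMn -!exprM mulnC.
by ring.
Qed.

Definition falling_poly k : {poly R} := \prod_(j < k) (1 - q ^- j *: 'X).

Lemma horner_falling_poly k x : (falling_poly k).[x] = falling k x.
Proof.
rewrite /falling_poly horner_prod; apply: eq_bigr => i _.
by rewrite !hornerE mulrC.
Qed.

Lemma falling_polyS k : falling_poly k.+1 = falling_poly k * (1 - q ^- k *: 'X).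
Proof. by rewrite /falling_poly big_ord_recr. Qed.

Lemma size_falling_poly k : size (falling_poly k) = k.+1.
Proof.
elim: k => [|k IH]; first by rewrite /falling_poly big_ord0 size_poly1.
rewrite falling_polyS; have sE : size (1 - q ^- k *: 'X : {poly R}) = 2.
  rewrite addrC size_polyDl size_polyN size_scale ?invr_neq0// size_polyX// size_poly1//.
rewrite size_mul ?IH ?sE ?addn2//; rewrite -size_poly_eq0 ?IH ?sE//.
Qed.

Lemma lead_falling_poly k : (falling_poly k)`_k = \prod_(j < k) (- q ^- j).
Proof.
elim: k => [|k IH]; first by rewrite /falling_poly !big_ord0 coef1.
rewrite falling_polyS mulrBr mulr1 -scalerAr coefB coefZ coefMX/= big_ord_recr/= -IH.
rewrite nth_default ?size_falling_poly//; ring.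
Qed.

Definition jacobi_poly m : {poly R} := \sum_(k < m.+1) jacobi_coef m k *: falling_poly k.

Lemma horner_jacobi_poly m x : (jacobi_poly m).[x] = little_jacobi m x.
Proof.
rewrite /jacobi_poly horner_sum; apply: eq_bigr => i _.
by rewrite hornerZ horner_falling_poly.
Qed.

Lemma size_jacobi_poly_le m : (size (jacobi_poly m) <= m.+1)%N.
Proof.
apply: (leq_trans (size_sum _ _ _)); apply/bigmax_leqP => i _.
by apply: (leq_trans (size_scale_leq _ _)); rewrite size_falling_poly.
Qed.

Lemma qpoch_lead m : qpoch (q ^- m) q m * (\prod_(j < m) (- q ^- j)) =
  qpoch q q m / q ^+ (m ^ 2).
Proof.
rewrite /qpoch [X in X * _](reindex_inj rev_ord_inj)/= -big_split/=.
have -> : \prod_(j < m) ((1 - q ^- m * q ^+ (m - j.+1)) * - q ^- j) =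
  \prod_(j < m) ((1 - q * q ^+ j) / q ^+ (2 * j).+1).
  apply: eq_bigr => j _.
  have mE : q ^+ m = q ^+ (m - j.+1) * q ^+ j.+1 by rewrite -exprD subnK.
  have -> : q ^+ (2 * j).+1 = q * (q ^+ j) ^+ 2 by rewrite exprS mulnC exprM.
  by rewrite mE exprS; field; rewrite !qX_neq0 q_neq0.
elim: m => [|m IH]; first by rewrite !big_ord0 expr0 divr1.
rewrite !big_ord_recr/= IH (_ : (m.+1 ^ 2 = m ^ 2 + (2 * m).+1)%N).
  by rewrite exprD; field; rewrite !qX_neq0.
by rewrite -addn1 sqrnD exp1n muln1 addnAC addn1 addnS.
Qed.

(** Leading coefficient; [jacobi_poly m] has degree m since it is nonzero. *)
Lemma lead_jacobi_poly m : (jacobi_poly m)`_m =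
  qpoch (a * b * q ^+ m.+1) q m / (qpoch (b * q) q m * a ^+ m * q ^+ (m ^ 2)).
Proof.
rewrite /jacobi_poly coef_sum big_ord_recr/= big1 ?add0r.
  rewrite coefZ lead_falling_poly /jacobi_coef.
  have -> : qpoch (q ^- m) q m * qpoch (a * b * q ^+ m.+1) q m /
    (qpoch (b * q) q m * qpoch q q m * a ^+ m) * (\prod_(j < m) - q ^- j) =
    (qpoch (q ^- m) q m * (\prod_(j < m) - q ^- j)) * qpoch (a * b * q ^+ m.+1) q m /
    (qpoch (b * q) q m * qpoch q q m * a ^+ m) by ring.
  rewrite qpoch_lead; field.
  by rewrite !qpoch_neq0// !expf_neq0.
by move=> i _; rewrite coefZ nth_default ?mulr0// size_falling_poly.
Qed.

Lemma qpoch_abq_neq0 m : qpoch (a * b * q ^+ m.+1) q m != 0.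
Proof.
by case: m => [|m]; [rewrite qpoch0 oner_neq0|rewrite qpoch_neq0// abqX_lt1].
Qed.

Lemma lead_jacobi_poly_neq0 m : (jacobi_poly m)`_m != 0.
Proof.
rewrite lead_jacobi_poly mulf_neq0 ?qpoch_abq_neq0// invr_neq0//.
by rewrite !mulf_neq0// ?qpoch_neq0// expf_neq0.
Qed.

(** Total mass of the dual weight. *)
Definition kappa : R := qpoch_inf (a * b * q ^+ 2) q / qpoch_inf (a * q) q.

Lemma kappa_gt0 : 0 < kappa.
Proof. by rewrite divr_gt0// qpoch_inf_gt0// abq2_lt1. Qed.

Lemma dual_quot_gt0 m : 0 < dual_quot q a b m.
Proof.
case: m => [|m] /=; first exact: ltr01.
rewrite mulr_gt0 ?qpoch_gt0 ?abq2_lt1// subr_gt0 abqX_lt1//.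
Qed.

Lemma dual_weight_gt0 m : 0 < dual_weight q a b m.
Proof.
rewrite /dual_weight !mulr_gt0 ?dual_quot_gt0 ?qpoch_gt0 ?exprn_gt0//.
by rewrite invr_gt0 mulr_gt0// qpoch_gt0.
Qed.

Lemma dual_quotE m : qpoch (a * b * q ^+ 2) q (2 * m) =
  dual_quot q a b m * qpoch (a * b * q ^+ m.+1) q m.
Proof.
case: m => [|m]; first by rewrite !qpoch0 mulr1.
have -> : (2 * m.+1 = (m + m.+1).+1)%N by rewrite mul2n -addnn addSn.
rewrite /dual_quot qpochS qpochD (_ : (2 * m.+1).+1 = 2 + (m + m.+1))%N; last first.
  by rewrite mul2n -addnn !addSn.
have -> : a * b * q ^+ m.+2 = a * b * q ^+ 2 * q ^+ m.
  by rewrite -[m.+2]/(2 + m)%N exprD mulrA.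
by rewrite (exprD q 2); ring.
Qed.

(** Squared norm of the m-th little q-Jacobi polynomial: leading coefficient times
    m-th moment. Up to the factor [kappa], it is the inverse of the dual weight. *)
Lemma lead_mul_momentE m :
  (jacobi_poly m)`_m * (qpoch_inf (a * b * q ^+ (m + m).+2) q /
     qpoch_inf (a * q ^+ m.+1) q * qpoch (q ^+ m.+1 / q ^+ m) q m) =
  kappa / dual_weight q a b m.
Proof.
have -> : q ^+ m.+1 / q ^+ m = q by rewrite exprS mulfK.
have E1 : qpoch_inf (a * b * q ^+ 2) q = dual_quot q a b m *
    qpoch (a * b * q ^+ m.+1) q m * qpoch_inf (a * b * q ^+ (m + m).+2) q.
  rewrite -dual_quotE (@qpoch_infD _ _ _ _ _ (2 * m)) ?abq2_lt1//.
  by rewrite -[a * b * _ * _]mulrA -exprD mul2n -addnn.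
have E2 : qpoch_inf (a * q) q = qpoch (a * q) q m * qpoch_inf (a * q ^+ m.+1) q.
  by rewrite (@qpoch_infD _ _ _ _ _ m)// -[a * q * _]mulrA -exprS.
have I0 : qpoch_inf (a * q ^+ m.+1) q != 0.
  by rewrite gt_eqF// qpoch_inf_gt0// exprS mulrA mul_qX_lt1.
have Q0 : dual_quot q a b m != 0 by rewrite gt_eqF// dual_quot_gt0.
rewrite lead_jacobi_poly /kappa /dual_weight E1 E2; field.
by rewrite Q0 I0 !qpoch_neq0// !expf_neq0.
Qed.

(** Orthogonality of the little q-Jacobi polynomials. *)
Lemma jacobi_orth m m' :
  series (fun n => jweight n * little_jacobi m (q ^+ n) * little_jacobi m' (q ^+ n))
    @ \oo --> kappa / dual_weight q a b m * (m == m')%:R.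
Proof.
wlog mm' : m m' / (m' <= m)%N.
  move=> H; have [/H//|/ltnW/H H'] := leqP m' m.
  have -> : kappa / dual_weight q a b m * (m == m')%:R =
            kappa / dual_weight q a b m' * (m' == m)%:R.
    by have [->//|] := eqVneq m m'; rewrite eq_sym !mulr0.
  by apply: series_cvg_ext H' => n; ring.
pose S l := qpoch_inf (a * b * q ^+ (l + m).+2) q / qpoch_inf (a * q ^+ l.+1) q
  * qpoch (q ^+ l.+1 / q ^+ m) q m.
have S0 l : (l < m)%N -> S l = 0.
  move=> lm; rewrite /S [X in _ * X](_ : _ = 0) ?mulr0//.
  have lm' : (m - l.+1 < m)%N by rewrite ltn_subrL (leq_trans _ lm).
  rewrite /qpoch (bigD1 (Ordinal lm'))//= mulrAC -exprD subnKC// divff//.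
  by rewrite subrr mul0r.
have H N : (N <= m.+1)%N -> series (fun n => \sum_(l < N) (jacobi_poly m')`_l *
     (jweight n * little_jacobi m (q ^+ n) * (q ^+ n) ^+ l)) @ \oo -->
   \sum_(l < N) (jacobi_poly m')`_l * S l.
  elim: N => [_|N IH Nm].
    rewrite big_ord0 (_ : series _ = fun=> 0); first exact: cvg_cst.
    by apply/funext => n; rewrite /series/= big1// => i _; rewrite big_ord0.
  rewrite big_ord_recr/=.
  have mN : series (fun n => jweight n * little_jacobi m (q ^+ n) * (q ^+ n) ^+ N)
      @ \oo --> S N by exact: jacobi_moment.
  have := series_cvgD (IH (ltnW Nm)) (series_cvgZ (jacobi_poly m')`_N mN).
  by apply: series_cvg_ext => n; rewrite [RHS]big_ord_recr.
have := H m.+1 (leqnn _).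
rewrite big_ord_recr/= big1 ?add0r; last by move=> i _; rewrite S0 ?mulr0.
have -> : (jacobi_poly m')`_m * S m = kappa / dual_weight q a b m * (m == m')%:R.
  have [<-|neq] := eqVneq m m'; first by rewrite mulr1 lead_mul_momentE.
  rewrite nth_default ?mul0r ?mulr0// (leq_trans (size_jacobi_poly_le _))//.
  by rewrite ltn_neqAle eq_sym neq.
apply: series_cvg_ext => n.
rewrite -[in RHS](horner_jacobi_poly m') (@horner_coef_wide _ m.+1).
  by rewrite [in RHS]mulr_sumr; apply: eq_bigr => i _; ring.
by rewrite (leq_trans (size_jacobi_poly_le _)).
Qed.

(** The m-th little q-Jacobi polynomial as a sequence in n. *)
Definition jvec m n : R := little_jacobi m (q ^+ n).
(** Squared norm of [jvec m]. *)
Definition jnorm m : R := kappa / dual_weight q a b m.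

Lemma jnorm_gt0 m : 0 < jnorm m.
Proof. by rewrite divr_gt0 ?kappa_gt0 ?dual_weight_gt0. Qed.

Lemma jweight_ge0 n : 0 <= jweight n.
Proof. exact/ltW/jweight_gt0. Qed.

Lemma sq_summable_jvec m : sq_summable jweight (jvec m).
Proof.
suff H : series (fun n => jweight n * jvec m n ^+ 2) @ \oo --> jnorm m * (m == m)%:R.
  exact: cvgP H.
by apply: series_cvg_ext (@jacobi_orth m m) => n; rewrite /jvec; ring.
Qed.

Lemma wdot_jvec m m' : wdot jweight (jvec m) (jvec m') = jnorm m * (m == m')%:R.
Proof. by apply: wdotP; exact: jacobi_orth. Qed.

(** The polynomials of degree less than M are the combinations of the first M little
    q-Jacobi polynomials. *)
Lemma jacobi_poly_span M (p : {poly R}) : (size p <= M)%N ->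
  exists c : nat -> R, p = \sum_(m < M) c m *: jacobi_poly m.
Proof.
elim: M p => [|M IH] p sp.
  by exists (fun=> 0); rewrite big_ord0; apply/eqP; rewrite -size_poly_leq0.
pose k := p`_M / (jacobi_poly M)`_M.
have [|c pE] := IH (p - k *: jacobi_poly M).
  apply/leq_sizeP => j; rewrite leq_eqVlt => /orP[/eqP <-|Mj].
    by rewrite coefB coefZ divfK ?subrr// lead_jacobi_poly_neq0.
  rewrite coefB coefZ !nth_default ?mulr0 ?subr0//.
    exact: leq_trans (size_jacobi_poly_le _) _.
  exact: leq_trans sp _.
exists (fun m => if m == M then k else c m).
rewrite big_ord_recr/= eqxx (eq_bigr (fun m : 'I_M => c m *: jacobi_poly m)).
  by rewrite -pE subrK.
by move=> i _; rewrite ltn_eqF.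
Qed.

(** The unit sequences are limits of polynomials in x = q^n. *)
Lemma expands_delta_jvec n : expands jweight jvec jnorm (delta n).
Proof.
apply: expands_of_approx; first exact: jweight_ge0.
- exact: jnorm_gt0.
- exact: sq_summable_jvec.
- exact: wdot_jvec.
- exact: sq_summable_delta.
move=> eps eps0.
have sW : series jweight @ \oo --> qpoch_inf (b * q * (a * q)) q / qpoch_inf (a * q) q.
  exact: q_binomial.
set W := qpoch_inf _ q / _ in sW.
have W0 : 0 <= W.
  rewrite -(cvg_lim (@Rhausdorff R) sW); apply: limr_ge; first exact: cvgP sW.
  by apply: nearW => N; apply: sumr_ge0 => i _; exact: jweight_ge0.
pose K := (qpoch q q n)^-1.
have K0 : 0 < K by rewrite invr_gt0 qpoch_gt0.
have fn : falling n (q ^+ n) = qpoch q q n.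
  by have := falling_qpoch n 0; rewrite add0n qpoch0 mulr1.
have [N NP] : exists N, (q ^+ N) ^+ 2 * (K ^+ 2 * W) < eps.
  have : (fun N => (q ^+ N) ^+ 2 * (K ^+ 2 * W)) @ \oo --> (0 * 0) * (K ^+ 2 * W).
    apply: cvgM; last exact: cvg_cst.
    by apply: cvgM; exact: cvg_qX.
  rewrite !mul0r => /cvgrPdist_lt/(_ _ eps0)[N _ /(_ N (leqnn N))/= NP].
  exists N; apply: le_lt_trans NP; rewrite sub0r normrN; exact: ler_norm.
(* p vanishes at q^i for i < n, takes the value 1 at q^n, and is at most K q^N in
   absolute value at q^i for i > n. *)
pose p : {poly R} := (K / q ^+ (n * N)) *: ('X ^+ N * falling_poly n).
have pE i : p.[q ^+ i] = K / q ^+ (n * N) * (q ^+ (i * N) * falling n (q ^+ i)).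
  by rewrite /p hornerZ hornerM horner_falling_poly hornerXn -exprM.
have [c pc] := @jacobi_poly_span (size p) p (leqnn _).
exists (size p), c.
have -> : (fun m => delta n m - \sum_(k < size p) c k * jvec k m) =
          (fun m => delta n m - p.[q ^+ m]).
  apply/funext => m; congr (_ - _); have := congr1 (horner^~ (q ^+ m)) pc.
  rewrite /= horner_sum => ->.
  by apply: eq_bigr => i _; rewrite hornerZ horner_jacobi_poly.
apply: le_lt_trans NP.
have dom i : (delta n i - p.[q ^+ i]) ^+ 2 <= (q ^+ N) ^+ 2 * K ^+ 2.
  rewrite pE /delta; case: (ltngtP i n) => [lt_in|lt_ni|->].
  - by rewrite falling_eq0// !mulr0 subr0 expr0n mulr_ge0 ?sqr_ge0.
  - have [f0 f1] : 0 <= falling n (q ^+ i) /\ falling n (q ^+ i) <= 1.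
      by apply/andP; rewrite falling_ge0_le1// ltnW.
    have qX_ge0 j : 0 <= q ^+ j by rewrite exprn_ge0.
    have K_ge0 := ltW K0.
    rewrite sub0r sqrrN -exprMn lerXn2r ?nnegrE ?mulr_ge0 ?invr_ge0//;
      try by rewrite ltW// qpoch_gt0.
    have iN : (i * N = n * N + (i - n) * N)%N by rewrite -mulnDl subnKC// ltnW.
    have -> : K / q ^+ (n * N) * (q ^+ (i * N) * falling n (q ^+ i)) =
        (q ^+ ((i - n) * N) * falling n (q ^+ i)) * K.
      by rewrite iN exprD; field; rewrite qX_neq0.
    rewrite ler_wpM2r ?(ltW K0)//.
    apply: (@le_trans _ _ (q ^+ ((i - n) * N))); first by rewrite ler_piMr// ltW.
    apply: ler_wiXn2l => //; first exact: ltW.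
    by rewrite leq_pmull// subn_gt0.
  - have -> : K / q ^+ (n * N) * (q ^+ (n * N) * falling n (q ^+ n)) = 1.
      by rewrite mulrA divfK// fn mulVf// qpoch_neq0.
    by rewrite subrr expr0n mulr_ge0 ?sqr_ge0.
have cD := series_cvgZ ((q ^+ N) ^+ 2 * K ^+ 2) sW.
have su : sq_summable jweight (fun m => delta n m - p.[q ^+ m]).
  apply: (series_le_cvg _ _ _ (cvgP _ cD)) => i.
  - exact: mulr_ge0 (jweight_ge0 i) (sqr_ge0 _).
  - exact: mulr_ge0 (mulr_ge0 (sqr_ge0 _) (sqr_ge0 _)) (jweight_ge0 i).
  - by rewrite mulrC ler_wpM2r// jweight_ge0.
rewrite -(cvg_lim (@Rhausdorff R) (cvg_sqnorm jweight_ge0 su)) mulrA.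
rewrite -(cvg_lim (@Rhausdorff R) cD); apply: lim_series_le => //.
- exact: cvgP cD.
- by move=> i; rewrite mulrC ler_wpM2r// jweight_ge0.
Qed.

(** Orthogonality of the dual polynomials: Parseval identity for two unit
    sequences expanded along the little q-Jacobi polynomials. *)
Theorem dual_orth n n' :
  series (fun m => dual_weight q a b m * jvec m n * jvec m n') @ \oo -->
  kappa / jweight n * (n == n')%:R.
Proof.
have := parseval jweight_ge0 jnorm_gt0 sq_summable_jvec wdot_jvec
  (expands_delta_jvec n) (expands_delta_jvec n').
rewrite wdot_delta => /(series_cvgZ (kappa / (jweight n * jweight n'))).
have W0 i : jweight i != 0 by rewrite gt_eqF// jweight_gt0.
have -> : kappa / (jweight n * jweight n') * (jweight n * delta n' n) =
    kappa / jweight n * (n == n')%:R.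
  rewrite /delta; have [->|_] := eqVneq n n'; last by rewrite !mulr0.
  by field; rewrite W0.
apply: series_cvg_ext => m; rewrite !wdot_delta /jnorm; field.
by rewrite !W0 !gt_eqF// ?kappa_gt0// dual_weight_gt0.
Qed.

(** The n-th dual polynomial as a sequence in m. *)
Definition dvec n m : R := jvec m n.
(** Squared norm of [dvec n]. *)
Definition dnorm n : R := kappa / jweight n.

Lemma dnorm_gt0 n : 0 < dnorm n.
Proof. by rewrite divr_gt0 ?kappa_gt0 ?jweight_gt0. Qed.

Lemma dual_weight_ge0 m : 0 <= dual_weight q a b m.
Proof. exact/ltW/dual_weight_gt0. Qed.

Lemma sq_summable_dvec n : sq_summable (dual_weight q a b) (dvec n).
Proof.
suff H : series (fun m => dual_weight q a b m * dvec n m ^+ 2) @ \oo -->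
    kappa / jweight n * (n == n)%:R by exact: cvgP H.
by apply: series_cvg_ext (@dual_orth n n) => m; rewrite /dvec; ring.
Qed.

Lemma wdot_dvec n n' :
  wdot (dual_weight q a b) (dvec n) (dvec n') = dnorm n * (n == n')%:R.
Proof. by apply: wdotP; exact: dual_orth. Qed.

(** Completeness of the dual polynomials: the Parseval identity for the unit
    sequence at m is the formula for the norm of the m-th little q-Jacobi polynomial. *)
Theorem dual_complete f : sq_summable (dual_weight q a b) f ->
  expands (dual_weight q a b) dvec dnorm f.
Proof.
have w0 m : dual_weight q a b m != 0 by rewrite gt_eqF// dual_weight_gt0.
apply: expands_total.
- exact: dual_weight_ge0.
- exact: dnorm_gt0.
- exact: sq_summable_dvec.
- exact: wdot_dvec.
move=> m; apply: expands_of_parseval.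
- exact: dual_weight_ge0.
- exact: dnorm_gt0.
- exact: sq_summable_dvec.
- exact: wdot_dvec.
- exact: sq_summable_delta.
rewrite wdot_delta /delta eqxx mulr1.
have := series_cvgZ (dual_weight q a b m ^+ 2 / kappa) (@jacobi_orth m m).
have k0 : kappa != 0 by rewrite gt_eqF// kappa_gt0.
have -> : dual_weight q a b m ^+ 2 / kappa *
  (kappa / dual_weight q a b m * (m == m)%:R) = dual_weight q a b m.
  by rewrite eqxx mulr1; field; rewrite w0 k0.
apply: series_cvg_ext => n; rewrite wdot_delta /dvec /jvec /dnorm; field.
by rewrite k0 gt_eqF// jweight_gt0.
Qed.

(** The factors of the terminating 3phi1 series that depend on n only, with the
    power -1 of the sign factor, recombine into [falling]. *)
Lemma qpoch_falling n k : qpoch (q ^- n) q k * ((-1) ^+ k * q ^+ 'C(k, 2))^-1 *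
  (q ^+ n) ^+ k = falling k (q ^+ n).
Proof.
elim: k => [|k IH].
  by rewrite qpoch0 bin0n /falling big_ord0 /= !expr0 !mulr1 invr1 mulr1.
rewrite qpochS fallingS -IH binS bin1 exprD !exprS; field.
by rewrite !qX_neq0 expf_neq0// oppr_eq0 oner_neq0.
Qed.

Lemma qpoch_eq0 m k : (m < k)%N -> qpoch (q ^- m) q k = 0.
Proof.
by move=> mk; rewrite /qpoch (bigD1 (Ordinal mk))//= mulVf// subrr mul0r.
Qed.

(** General term of the series defining the n-th dual polynomial at mu(m). *)
Definition dual_term n m k := jacobi_coef m k * falling k (q ^+ n).

Lemma dual_term_eq0 n m k : (m < k)%N || (n < k)%N -> dual_term n m k = 0.
Proof.
rewrite /dual_term => /orP[mk|nk]; last by rewrite falling_eq0// mulr0.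
by rewrite /jacobi_coef qpoch_eq0// !mul0r.
Qed.

(** The series terminates at min(m, n), hence any larger bound may be used. *)
Lemma dual_qJacobiE n m N : (n < N)%N || (m < N)%N ->
  dual_qJacobi q a b n m = \sum_(k < N) dual_term n m k.
Proof.
move=> nmN; rewrite /dual_qJacobi /rphis.
apply: (cvg_lim (@Rhausdorff R)); apply: cvg_near_cst; near=> M.
have NM : (N <= M)%N by near: M; exact: nbhs_infty_ge.
rewrite -(big_mkord xpredT (dual_term n m)) /series/= (big_cat_nat (leq0n N) NM)/=.
have tE k : qpochs [:: q ^- m; a * b * q ^+ m.+1; q ^- n] q k /
   qpochs [:: b * q; q] q k * ((-1) ^+ k * q ^+ 'C(k, 2)) ^
     (1 + (1%N : int) - (3%N : int)) * (q ^+ n / a) ^+ k = dual_term n m k.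
  rewrite (_ : 1 + _ - _ = -1)// exprN1 /qpochs !big_cons !big_nil !mulr1.
  rewrite exprMn [a^-1 ^+ k]exprVn /dual_term -qpoch_falling /jacobi_coef; field.
  rewrite !qpoch_neq0// !expf_neq0// oppr_eq0 oner_neq0//.
rewrite (eq_big_nat _ _ (fun k _ => tE k)) (eq_big_nat _ _ (fun k _ => tE k)).
rewrite [X in _ + X]big_nat [X in _ + X]big1 ?addr0// => k /andP[Nk _].
apply: dual_term_eq0; case/orP: nmN => [nN|mN]; apply/orP; [right|left].
  exact: leq_trans Nk.
exact: leq_trans Nk.
Unshelve. all: by end_near. Qed.

Lemma dual_qJacobi_dvec n m : dual_qJacobi q a b n m = dvec n m.
Proof. by rewrite (@dual_qJacobiE _ _ m.+1)// ltnSn orbT. Qed.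

(** (q^-m, a b q^(m+1); q)_k as a polynomial in mu(m). *)
Definition node_poly k : {poly R} :=
  \prod_(j < k) ((1 + a * b * q ^+ (2 * j).+1)%:P - q ^+ j *: 'X).

(** The n-th dual little q-Jacobi polynomial in the variable mu. *)
Definition dual_poly n : {poly R} :=
  \sum_(k < n.+1) (falling k (q ^+ n) / (qpoch (b * q) q k * qpoch q q k * a ^+ k))
     *: node_poly k.

Lemma horner_node_poly k m : (node_poly k).[dual_node q a b m] =
  qpoch (q ^- m) q k * qpoch (a * b * q ^+ m.+1) q k.
Proof.
rewrite /node_poly horner_prod /qpoch -big_split/=; apply: eq_bigr => j _.
rewrite !hornerE /dual_node exprS mulnC exprM [q ^+ m.+1]exprS; field.
exact: qX_neq0.
Qed.

Lemma horner_dual_poly n m : (dual_poly n).[dual_node q a b m] = dual_qJacobi q a b n m.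
Proof.
rewrite (@dual_qJacobiE _ _ n.+1) ?ltnSn// /dual_poly horner_sum.
apply: eq_bigr => k _; rewrite hornerZ horner_node_poly /dual_term /jacobi_coef; ring.
Qed.

Lemma size_node_poly k : size (node_poly k) = k.+1.
Proof.
elim: k => [|k IH]; first by rewrite /node_poly big_ord0 size_poly1.
rewrite /node_poly big_ord_recr -/(node_poly k)/=.
have sE : size ((1 + a * b * q ^+ (2 * k).+1)%:P - q ^+ k *: 'X : {poly R}) = 2.
  rewrite addrC size_polyDl size_polyN size_scale// size_polyX//.
  by rewrite (leq_ltn_trans (size_polyC_leq1 _)).
by rewrite size_mul ?IH ?sE ?addn2//; rewrite -size_poly_eq0 ?IH ?sE.
Qed.

Lemma size_dual_poly n : size (dual_poly n) = n.+1.
Proof.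
have sz k : falling k (q ^+ n) != 0 -> size ((falling k (q ^+ n) /
    (qpoch (b * q) q k * qpoch q q k * a ^+ k)) *: node_poly k) = k.+1.
  move=> f0; rewrite size_scale ?size_node_poly// mulf_neq0// invr_neq0//.
  by rewrite !mulf_neq0 ?qpoch_neq0// expf_neq0.
have fn : falling n (q ^+ n) != 0.
  have := falling_qpoch n 0; rewrite add0n qpoch0 mulr1 => ->.
  exact: qpoch_neq0.
rewrite /dual_poly big_ord_recr/= addrC size_polyDl sz//.
rewrite ltnS; apply: (leq_trans (size_sum _ _ _)); apply/bigmax_leqP => i _.
by apply: (leq_trans (size_scale_leq _ _)); rewrite size_node_poly.
Qed.

End LittleQJacobi.

(** * Complex l2 spaces *)

Lemma Re_sub_comb (R : realType) N (z : R[i]) (c : nat -> R[i]) (r : nat -> R) :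
  complex.Re (z - \sum_(n < N) c n * (r n)%:C) =
  complex.Re z - \sum_(n < N) complex.Re (c n) * r n.
Proof.
rewrite raddfB raddf_sum; congr (_ - _); apply: eq_bigr => n _.
by case: (c n) => x y /=; rewrite mulr0 subr0.
Qed.

Lemma Im_sub_comb (R : realType) N (z : R[i]) (c : nat -> R[i]) (r : nat -> R) :
  complex.Im (z - \sum_(n < N) c n * (r n)%:C) =
  complex.Im z - \sum_(n < N) complex.Im (c n) * r n.
Proof.
rewrite raddfB raddf_sum; congr (_ - _); apply: eq_bigr => n _.
by case: (c n) => x y /=; rewrite mulr0 add0r.
Qed.

Section ComplexL2.
Variables (R : realType) (w : nat -> R).
Hypothesis w_ge0 : forall m, 0 <= w m.
Implicit Types (f : nat -> R[i]).

Lemma sqr_normcE (z : R[i]) :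
  Normc.normc z ^+ 2 = complex.Re z ^+ 2 + complex.Im z ^+ 2.
Proof. by case: z => x y /=; rewrite sqr_sqrtr// addr_ge0 ?sqr_ge0. Qed.

Lemma mul_conj_normc (z : R[i]) : z * Num.conj z = (Normc.normc z ^+ 2)%:C.
Proof.
have -> : Num.conj z = z^*%C by [].
rewrite sqr_normcE; case: z => x y; apply/eqP; rewrite eq_complex/=.
by apply/andP; split; apply/eqP; ring.
Qed.

Lemma cvg_real_complex (u : nat -> R) (l : R) : u @ \oo --> l ->
  (fun n => (u n)%:C : R[i]^o) @ \oo --> (l%:C : R[i]^o).
Proof.
move=> /cvgrPdist_lt ul; apply/cvgrPdist_lt => -[r s]; rewrite ltcE/=.
move=> /andP[/eqP -> r0].
have := ul r r0; apply: filterS => n /= H.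
rewrite -rmorphB/= normc_def/= expr0n addr0 sqrtr_sqr ltcE/= eqxx//.
Qed.

Lemma l2_dot_real (f g : nat -> R[i]) (s : R) (u : nat -> R) :
  (forall m, (w m)%:C * f m * Num.conj (g m) = (u m)%:C) ->
  series u @ \oo --> s -> l2_dot w f g = s%:C.
Proof.
move=> uE us.
have E : (series (fun m => (w m)%:C * f m * Num.conj (g m)) : nat -> R[i]^o) =
    (fun n => (series u n)%:C).
  apply/funext => n; rewrite /series/= rmorph_sum.
  by apply: eq_bigr => i _; rewrite uE.
rewrite /l2_dot E.
exact: (cvg_lim (@norm_hausdorff _ (R[i]^o)) (cvg_real_complex us)).
Qed.

Lemma l2_sq_summable f : l2 w f ->
  sq_summable w (fun m => complex.Re (f m)) /\ sq_summable w (fun m => complex.Im (f m)).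
Proof.
have w2_ge0 (u : nat -> R) m : 0 <= w m * u m ^+ 2 by rewrite mulr_ge0 ?sqr_ge0.
have n_ge0 := w2_ge0 (fun m => Normc.normc (f m)).
move=> lf; split; apply: (series_le_cvg (w2_ge0 _) n_ge0 _ lf) => m.
- by rewrite ler_wpM2l// sqr_normcE lerDl sqr_ge0.
- by rewrite ler_wpM2l// sqr_normcE lerDr sqr_ge0.
Qed.

Variables (e : nat -> nat -> R) (h : nat -> R).
Hypothesis h_gt0 : forall n, 0 < h n.
Hypothesis e_sq : forall n, sq_summable w (e n).
Hypothesis e_orth : forall n n', wdot w (e n) (e n') = h n * (n == n')%:R.
Hypothesis e_complete : forall u, sq_summable w u -> expands w e h u.

(** A complex sequence is approximated through its real and imaginary parts, with
    a common number of terms. *)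
Lemma complex_approx f (eps : R) :
  sq_summable w (fun m => complex.Re (f m)) ->
  sq_summable w (fun m => complex.Im (f m)) -> 0 < eps ->
  exists (N : nat) (c : nat -> R[i]) (s : R), s < eps /\
    series (fun m => w m *
      Normc.normc (f m - \sum_(n < N) c n * (e n m)%:C) ^+ 2) @ \oo --> s.
Proof.
set u := fun m => _; set v := fun m => _ => su sv eps0.
have [[_ /cvgrPdist_lt cu] [_ /cvgrPdist_lt cv]] := (e_complete su, e_complete sv).
have eps2 : 0 < eps / 2 by lra.
have [N [uN vN]] : exists N, wdot w (resid w e h N u) (resid w e h N u) < eps / 2 /\
    wdot w (resid w e h N v) (resid w e h N v) < eps / 2.
  have := filterI (cu _ eps2) (cv _ eps2).
  case=> N _ /(_ N (leqnn N)) /= [H1 H2]; exists N.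
  by rewrite !sub0r !normrN in H1 H2; split; [exact: le_lt_trans (ler_norm _) H1|
    exact: le_lt_trans (ler_norm _) H2].
pose c n := fcoef w e h u n +i* fcoef w e h v n.
exists N, c.
exists (wdot w (resid w e h N u) (resid w e h N u) +
        wdot w (resid w e h N v) (resid w e h N v)); split; first by lra.
have := series_cvgD (cvg_sqnorm w_ge0 (sq_resid w_ge0 h e_sq N su))
                    (cvg_sqnorm w_ge0 (sq_resid w_ge0 h e_sq N sv)).
apply: series_cvg_ext => m; rewrite -mulrDr; congr (_ * _).
by rewrite sqr_normcE (Re_sub_comb _ _ c (e^~ m)) (Im_sub_comb _ _ c (e^~ m)).
Qed.

(** A real complete orthogonal system is an orthogonal basis of the complex l2(w). *)
Theorem l2_basis : l2_orthogonal_basis w (fun n m => (e n m)%:C).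
Proof.
have dotE n n' : l2_dot w (fun m => (e n m)%:C) (fun m => (e n' m)%:C) =
    (h n * (n == n')%:R)%:C.
  rewrite -e_orth; apply: (l2_dot_real (u := fun m => w m * e n m * e n' m)); last first.
    exact: cvg_wdot.
  move=> m.
  by rewrite (_ : Num.conj _ = (e n' m)%:C) ?rmorphM//; exact: conjc_real.
split.
- move=> n; have := @e_sq n; rewrite /l2 /sq_summable.
  rewrite (_ : (fun m => w m * e n m ^+ 2) =
    (fun m => w m * Normc.normc (e n m)%:C ^+ 2))//.
  by apply/funext => m; rewrite sqr_normcE/= expr0n addr0.
- by move=> n; rewrite dotE eqxx mulr1 (inj_eq (@complexI R)) gt_eqF.
- by move=> n n' /negbTE nn'; rewrite dotE nn' mulr0.
move=> f /l2_sq_summable[su sv] eps eps0.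
have [|N [c [s [lts cvs]]]] := @complex_approx f (eps ^+ 2) su sv.
  by rewrite exprn_gt0.
exists N, c; rewrite /l2_norm (@l2_dot_real _ _ s _ _ cvs)/=; last first.
  by move=> m; rewrite rmorphM/= -mulrA; congr (_ * _); exact: mul_conj_normc.
by rewrite -[ltRHS](gtr0_norm eps0) -sqrtr_sqr ltr_sqrt// exprn_gt0.
Qed.

End ComplexL2.

(** * Discrete measures on the line *)

Section PointMeasure.
Variables (R : realType) (w x : nat -> R).
Hypothesis w_ge0 : forall m, 0 <= w m.

(** The discrete measure with mass [w m] at [x m]. *)
Definition point_measure : {measure set (measurableTypeR R) -> \bar R} :=
  mseries (fun m => mscale (NngNum (w_ge0 m)) (dirac (x m : measurableTypeR R))) 0.

Lemma point_measureP : is_point_measure point_measure w x.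
Proof. by move=> A mA. Qed.

Lemma integral_point_measure (f : measurableTypeR R -> \bar R) :
  measurable_fun setT f -> (forall t, 0 <= f t)%E ->
  (\int[point_measure]_t f t = \sum_(0 <= m <oo) (w m)%:E * f (x m))%E.
Proof.
move=> mf f0; rewrite ge0_integral_measure_series//.
apply: eq_eseriesr => m _; rewrite ge0_integral_mscale//= integral_dirac//.
by rewrite diracT mul1e.
Qed.

Lemma integral_point_measure_ge0 (f : measurableTypeR R -> R) (s : R) :
  measurable_fun setT f -> (forall t, 0 <= f t) ->
  series (fun m => w m * f (x m)) @ \oo --> s ->
  (\int[point_measure]_t (f t)%:E = s%:E)%E.
Proof.
move=> mf f0 fs; rewrite integral_point_measure//; last first.
  exact/measurable_EFinP.
rewrite -(cvg_lim (@Rhausdorff R) fs) -EFin_lim; last exact: cvgP fs.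
by congr (limn _); apply/funext => n; rewrite /series/= -sumEFin.
Qed.

(** The positive and negative parts of f are (|f| + f) / 2 and (|f| - f) / 2. *)
Lemma integral_point_measure_0 (f : measurableTypeR R -> R) :
  measurable_fun setT f ->
  cvgn (series (fun m => w m * `|f (x m)|)) ->
  series (fun m => w m * f (x m)) @ \oo --> (0 : R) ->
  (\int[point_measure]_t (f t)%:E = 0)%E.
Proof.
move=> mf /cvg_ex[/= A cA] c0.
have mabs : measurable_fun setT (fun t => `|f t|) by exact: measurableT_comp.
have posE : (fun t => (f t)%:E)^\+%E = fun t => (2^-1 * (`|f t| + f t))%:E.
  apply/funext => t; rewrite funeposE -EFin_max; congr (_%:E).
  by have [ft|ft] := leP 0 (f t); [rewrite ger0_norm//|rewrite ltr0_norm//]; lra.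
have negE : (fun t => (f t)%:E)^\-%E = fun t => (2^-1 * (`|f t| - f t))%:E.
  apply/funext => t; rewrite funenegE -EFinN -EFin_max; congr (_%:E).
  have [ft|ft] := leP 0 (f t).
    by rewrite ger0_norm// max_r; lra.
  by rewrite ltr0_norm// max_l; lra.
rewrite integralE posE negE.
rewrite (@integral_point_measure_ge0 _ (2^-1 * (A + 0))); last 3 first.
- by apply: measurable_funM => //; exact: measurable_funD.
- by move=> t; have := ler_norm (- f t); rewrite normrN; lra.
- by apply: series_cvg_ext (series_cvgZ 2^-1 (series_cvgD cA c0)) => m; ring.
rewrite (@integral_point_measure_ge0 _ (2^-1 * (A - 0))); last 3 first.
- by apply: measurable_funM => //; exact: measurable_funB.
- by move=> t; have := ler_norm (f t); lra.
- by apply: series_cvg_ext (series_cvgZ 2^-1 (series_cvgB cA c0)) => m; ring.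
by rewrite -EFinB addr0 subr0 subrr.
Qed.

Lemma point_measure_lty (f : measurableTypeR R -> R) :
  measurable_fun setT f -> (forall t, 0 <= f t) ->
  (\int[point_measure]_t (f t)%:E < +oo)%E ->
  cvgn (series (fun m => w m * f (x m))).
Proof.
move=> mf f0; rewrite integral_point_measure//; last exact/measurable_EFinP.
by apply: nnseries_is_cvg => m; rewrite mulr_ge0.
Qed.

Lemma measurable_horner (p : {poly R}) :
  measurable_fun setT ((fun t => p.[t]) : measurableTypeR R -> R).
Proof. exact: (continuous_measurable_fun (@continuous_horner R p)). Qed.

Variables (e : nat -> nat -> R) (h : nat -> R) (p : nat -> {poly R}).
Hypothesis h_gt0 : forall n, 0 < h n.
Hypothesis e_sq : forall n, sq_summable w (e n).
Hypothesis e_orth : forall n n', wdot w (e n) (e n') = h n * (n == n')%:R.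
Hypothesis e_complete : forall u, sq_summable w u -> expands w e h u.
Hypothesis pE : forall n m, (p n).[x m] = e n m.

Lemma measurable_normc2 (f : R -> R[i]) : measurable_cfun f ->
  measurable_fun setT ((fun t => Normc.normc (f t) ^+ 2) : measurableTypeR R -> R).
Proof.
move=> [mre mim].
rewrite (_ : (fun t => _) = (fun t => complex.Re (f t) ^+ 2 + complex.Im (f t) ^+ 2)).
  by apply: measurable_funD; exact: measurable_funX.
by apply/funext => t; exact: sqr_normcE.
Qed.

(** Polynomials whose values at the nodes form a complete orthogonal system of
    l2(w) make the point measure extremal. *)
Theorem extremal_point_measure : extremal point_measure p.
Proof.
have normc_p n t : Normc.normc ((p n).[t])%:C ^+ 2 = (p n).[t] ^+ 2.
  by rewrite sqr_normcE/= expr0n addr0.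
have sqE n : (\int[point_measure]_t ((p n).[t] ^+ 2)%:E)%E = (h n)%:E.
  apply: (@integral_point_measure_ge0 (fun t => (p n).[t] ^+ 2)).
  - by apply: measurable_funX; exact: measurable_horner.
  - by move=> t; exact: sqr_ge0.
  have := cvg_sqnorm w_ge0 (@e_sq n); rewrite e_orth eqxx mulr1.
  by apply: series_cvg_ext => m; rewrite pE.
split.
  split.
  - move=> n; split; first split => /=.
    + exact: measurable_horner.
    + exact: measurable_cst.
    rewrite /sqnorm_int; under eq_integral do rewrite normc_p.
    by rewrite sqE ltry.
  - by move=> n; rewrite sqE eqe gt_eqF.
  - move=> n n' /negbTE nn'.
    apply: (@integral_point_measure_0 (fun t => (p n).[t] * (p n').[t])).
    + by apply: measurable_funM; exact: measurable_horner.
    + have abs_sq k : sq_summable w (fun m => `|e k m|).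
        rewrite /sq_summable (_ : (fun m => _) = (fun m => w m * e k m ^+ 2)).
          exact: e_sq.
        by apply/funext => m; rewrite real_normK// num_real.
      have := cvg_wdot w_ge0 (abs_sq n) (abs_sq n') => /cvgP.
      rewrite (_ : (fun m => w m * `|e n m| * `|e n' m|) =
        (fun m => w m * `|(p n).[x m] * (p n').[x m]|))//.
      by apply/funext => m; rewrite !pE normrM mulrA.
    have := cvg_wdot w_ge0 (@e_sq n) (@e_sq n'); rewrite e_orth nn' mulr0.
    by apply: series_cvg_ext => m; rewrite !pE mulrA.
move=> f [mf sf] eps eps0; have [mre mim] := mf.
have cf := point_measure_lty (measurable_normc2 mf) (fun t => sqr_ge0 _) sf.
have [su sv] := l2_sq_summable w_ge0 (f := fun m => f (x m)) cf.
have [|N [c [s [lts cvs]]]] := 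
  complex_approx w_ge0 e_sq e_complete su sv (eps := eps ^+ 2).
  by rewrite exprn_gt0.
exists N, c; rewrite /sqnorm_int.
rewrite (@integral_point_measure_ge0 (fun t =>
  Normc.normc (f t - \sum_(n < N) c n * (p n).[t]%:C) ^+ 2) s) ?lte_fin//.
- apply: measurable_normc2; split.
    under eq_fun do rewrite (Re_sub_comb _ _ c (fun n => (p n).[_])).
    apply: measurable_funB => //; apply: measurable_sum => n.
    by apply: measurable_funM => //; exact: measurable_horner.
  under eq_fun do rewrite (Im_sub_comb _ _ c (fun n => (p n).[_])).
  apply: measurable_funB => //; apply: measurable_sum => n.
  by apply: measurable_funM => //; exact: measurable_horner.
- by move=> t; exact: sqr_ge0.
apply: series_cvg_ext cvs => m; congr (_ * Normc.normc (_ - _) ^+ 2).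
by apply: eq_bigr => n _; rewrite pE.
Qed.

End PointMeasure.

(** * Orthogonality and extremality *)

Theorem mainTheorem1 (R : realType) (q a b : R)
    (q_gt0 : 0 < q) (q_lt1 : q < 1)
    (a_gt0 : 0 < a) (a_ltVq : a < q^-1) (b_ltVq : b < q^-1) :
  [/\ forall n n' : nat,
        series (fun m => dual_weight q a b m
                         * dual_qJacobi q a b n m * dual_qJacobi q a b n' m)
          @ \oo -->
        qpoch_inf (a * b * q ^+ 2) q / qpoch_inf (a * q) q
        * (qpoch q q n * (a * q) ^- n / qpoch (b * q) q n) * (n == n')%:R,
      exists (p : nat -> {poly R})
             (nu : {measure set (measurableTypeR R) -> \bar R}),
        [/\ forall n, size (p n) = n.+1,
            forall n m, (p n).[dual_node q a b m] = dual_qJacobi q a b n m,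
            is_point_measure nu (dual_weight q a b) (dual_node q a b)
          & extremal nu p]
    & l2_orthogonal_basis (dual_weight q a b)
        (fun n m => (dual_qJacobi q a b n m)%:C)].
Proof.
have aq_lt1 : a * q < 1 by rewrite -ltr_pdivlMr// div1r.
have bq_lt1 : b * q < 1 by rewrite -ltr_pdivlMr// div1r.
have dE : dual_qJacobi q a b = dvec q a b.
  by apply/funext => n; apply/funext => m; exact: dual_qJacobi_dvec.
have w_ge0 := dual_weight_ge0 q_gt0 q_lt1 a_gt0 aq_lt1 bq_lt1.
have norm_gt0 := dnorm_gt0 q_gt0 q_lt1 a_gt0 aq_lt1 bq_lt1.
have d_sq := sq_summable_dvec q_gt0 q_lt1 a_gt0 aq_lt1 bq_lt1.
have d_orth := wdot_dvec q_gt0 q_lt1 a_gt0 aq_lt1 bq_lt1.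
have d_complete := dual_complete q_gt0 q_lt1 a_gt0 aq_lt1 bq_lt1.
split.
- move=> n n'; rewrite dE.
  rewrite (_ : qpoch q q n * _ / _ = (jweight q a b n)^-1).
    exact: dual_orth.
  rewrite /jweight; field.
  by rewrite !qpoch_neq0// expf_neq0// mulf_neq0// gt_eqF.
- exists (dual_poly q a b), (point_measure (dual_node q a b) w_ge0); split.
  + by move=> n; exact: size_dual_poly.
  + by move=> n m; exact: horner_dual_poly.
  + exact: point_measureP.
  apply: extremal_point_measure norm_gt0 d_sq d_orth d_complete _ => n m.
  by rewrite horner_dual_poly// dE.
rewrite dE; exact: l2_basis norm_gt0 d_sq d_orth d_complete.
Qed.
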